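(* Assume $\mathcal I\neq\emptyset$ and let $\mathcal M=\mathcal M(A,B)\subset{}^d\mathcal K$ be maximal isotropic. Then $$-\Delta(\mathcal M,\underline a)\ \geq\ -s(\|L_+\|)^2,$$ where $L_+$ is the positive part of the self-adjoint operator $L$ and $s(t)$ is the unique nonnegative solution $s$ of the equation $s\tanh\left(\frac{as}{2}\right)=t$, with $a=\min_{i\in\mathcal I}a_i$.
   Context: Let $\mathcal G=(V,\mathcal I,\mathcal E,\partial)$ be a finite connected graph: $V$ a finite set of vertices, $\mathcal I$ a finite set of internal edges, $\mathcal E$ a finite set of external edges; $\partial$ assigns to each $i\in\mathcal I$ an ordered pair $(\partial^-(i),\partial^+(i))$ of (possibly equal) vertices and to each $e\in\mathcal E$ a single vertex $\partial(e)$. Fix lengths $\underline a=\{a_i\}_{i\in\mathcal I}$, $a_i>0$; $I_i=[0,a_i]$ for $i\in\mathcal I$, $I_e=[0,\infty)$ for $e\in\mathcal E$. $\mathcal H=\bigoplus_{j}L^2(I_j)$; $\mathcal D$ is the set of $\psi\in\mathcal H$ with $\psi_j,\psi_j'$ absolutely continuous and $\psi_j''\in L^2$. $\mathcal K=\mathbb C^{|\mathcal E|}\oplus\mathbb C^{|\mathcal I|}\oplus\mathbb C^{|\mathcal I|}$, ${}^d\mathcal K=\mathcal K\oplus\mathcal K$. For $\psi\in\mathcal D$: $\underline\psi=(\{\psi_e(0)\}_{e},\{\psi_i(0)\}_{i},\{\psi_i(a_i)\}_{i})$, $\underline\psi'=(\{\psi_e'(0)\}_{e},\{\psi_i'(0)\}_{i},\{-\psi_i'(a_i)\}_{i})$.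 For linear $A,B:\mathcal K\to\mathcal K$ with $(A,B):{}^d\mathcal K\to\mathcal K$ of rank $|\mathcal E|+2|\mathcal I|$ and $AB^\dagger$ self-adjoint, $\mathcal M(A,B)=\{\chi_1\oplus\chi_2:A\chi_1+B\chi_2=0\}$ is a maximal isotropic subspace, and all maximal isotropic subspaces arise this way. $\Delta(\mathcal M,\underline a)$ is the self-adjoint operator $(\Delta\psi)_j=\psi_j''$ on $\{\psi\in\mathcal D: A\underline\psi+B\underline\psi'=0\}$. Let $P_{\ker B}$ be the orthogonal projection onto $\ker B$, $P^\perp_{\ker B}=\mathbb I-P_{\ker B}$, and $L=(B|_{\operatorname{Ran}B^\dagger})^{-1}AP^\perp_{\ker B}$; this is a self-adjoint operator on $\mathcal K$ depending only on $\mathcal M(A,B)$. *)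

(* Defs.v *)
From HB Require Import structures.
From mathcomp Require Import all_boot all_order all_algebra.
From mathcomp Require Import all_classical all_reals all_analysis.
From mathcomp Require Import complex.
Set Implicit Arguments. Unset Strict Implicit. Unset Printing Implicit Defensive.
Import Order.TTheory GRing.Theory Num.Theory.
Import numFieldNormedType.Exports.
Local Open Scope classical_set_scope.
Local Open Scope ring_scope.

Section Defs.
Variable R : realType.
Local Notation C := R[i].
Local Notation normc := (@ComplexField.Normc.normc R).

Definition RtoC (r : R) : C := Complex r 0.

Definition adjmx (m n : nat) (M : 'M[C]_(m, n)) : 'M[C]_(n, m) :=
  (map_mx (@conjc R) M)^T.

Definition vnorm2 (n : nat) (x : 'cV[C]_n) : R := \sum_(k < n) normc (x k 0) ^+ 2.
Definition vnorm (n : nat) (x : 'cV[C]_n) : R := Num.sqrt (vnorm2 x).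

Definition opnorm (n : nat) (M : 'M[C]_n) : R :=
  sup [set r : R | exists x : 'cV[C]_n, vnorm x = 1 /\ r = vnorm (M *m x)].

Definition orth_proj_ker (n : nat) (B P : 'M[C]_n) : Prop :=
  [/\ P *m P = P, adjmx P = P, B *m P = 0 &
      forall x : 'cV[C]_n, B *m x = 0 -> P *m x = x].

(** L = (B|_{Ran B^dagger})^{-1} A P^perp_{ker B}, characterised pointwise:
    L x is the (unique) element of Ran B^dagger whose image under B is
    A P^perp x. *)
Definition is_L (n : nat) (A B L : 'M[C]_n) : Prop :=
  exists P : 'M[C]_n, orth_proj_ker B P /\
  forall x : 'cV[C]_n,
    (exists y : 'cV[C]_n, L *m x = adjmx B *m y) /\
    B *m (L *m x) = A *m ((1%:M - P) *m x).

Definition is_pos_part (n : nat) (L Lp : 'M[C]_n) : Prop :=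
  exists (U : 'M[C]_n) (d : 'I_n -> R),
    [/\ adjmx U *m U = 1%:M,
        L = U *m diag_mx (\row_k RtoC (d k)) *m adjmx U &
        Lp = U *m diag_mx (\row_k RtoC (Num.max (d k) 0)) *m adjmx U].

Definition tanh (x : R) : R := (expR x - expR (- x)) / (expR x + expR (- x)).

Definition abs_cont_on (a b : R) (f : R -> C) : Prop :=
  forall eps : R, 0 < eps -> exists2 delta : R, 0 < delta &
    forall (m : nat) (x y : 'I_m -> R),
      (forall k, a <= x k /\ x k <= y k /\ y k <= b) ->
      (forall k l, k != l -> y k <= x l \/ y l <= x k) ->
      \sum_(k < m) (y k - x k) < delta ->
      \sum_(k < m) normc (f (y k) - f (x k)) < eps.

(** the edge interval I_j: [0, len] for an internal edge (len = Some a_i),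
    [0, +oo) for an external edge (len = None) *)
Definition edge_set (len : option R) : set R :=
  match len with
  | Some l => `[0, l]
  | None => `[0, +oo[
  end.

Definition abs_cont_edge (len : option R) (f : R -> C) : Prop :=
  match len with
  | Some l => abs_cont_on 0 l f
  | None => forall b : R, 0 < b -> abs_cont_on 0 b f
  end.

Definition has_deriv (f : R -> C) (x : R) (l : C) : Prop :=
  forall eps : R, 0 < eps -> exists2 delta : R, 0 < delta &
    forall y : R, y != x -> `|y - x| < delta ->
      normc ((f y - f x) / RtoC (y - x) - l) < eps.

Definition ae_deriv (len : option R) (f g : R -> C) : Prop :=
  {ae (@lebesgue_measure R), forall x, edge_set len x -> has_deriv f x (g x)}.

Definition L2_edge (len : option R) (f : R -> C) : Prop :=
  [/\ measurable_fun (edge_set len) (fun x => complex.Re (f x)),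
      measurable_fun (edge_set len) (fun x => complex.Im (f x)) &
      (\int[@lebesgue_measure R]_(x in edge_set len) ((normc (f x)) ^+ 2)%:E
         < +oo)%E].

Definition in_D_edge (len : option R) (psi dpsi ddpsi : R -> C) : Prop :=
  [/\ L2_edge len psi,
      abs_cont_edge len psi /\ ae_deriv len psi dpsi,
      abs_cont_edge len dpsi, ae_deriv len dpsi ddpsi &
      L2_edge len ddpsi].

Definition cint (len : option R) (f : R -> C) : C :=
  Complex (Rintegral (@lebesgue_measure R) (edge_set len) (fun x => complex.Re (f x)))
          (Rintegral (@lebesgue_measure R) (edge_set len) (fun x => complex.Im (f x))).

Definition inner_H (nE nI : nat) (a : 'I_nI -> R)
    (fE gE : 'I_nE -> R -> C) (fI gI : 'I_nI -> R -> C) : C :=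
  \sum_(e < nE) cint None (fun x => conjc (fE e x) * gE e x)
  + \sum_(i < nI) cint (Some (a i)) (fun x => conjc (fI i x) * gI i x).

Definition bval (nE nI : nat) (a : 'I_nI -> R)
    (psiE : 'I_nE -> R -> C) (psiI : 'I_nI -> R -> C) : 'cV[C]_(nE + nI + nI) :=
  col_mx (col_mx (\col_e psiE e 0) (\col_i psiI i 0)) (\col_i psiI i (a i)).

Definition bdval (nE nI : nat) (a : 'I_nI -> R)
    (dpsiE : 'I_nE -> R -> C) (dpsiI : 'I_nI -> R -> C) : 'cV[C]_(nE + nI + nI) :=
  col_mx (col_mx (\col_e dpsiE e 0) (\col_i dpsiI i 0))
         (\col_i (- dpsiI i (a i))).

End Defs.

Definition graph_connected (V : finType) (nI : nat) (dm dp : 'I_nI -> V) : Prop :=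
  forall u v : V,
    connect (fun x y => [exists i, ((dm i == x) && (dp i == y))
                                   || ((dm i == y) && (dp i == x))]) u v.

(* Main.v *)
(** The form [<psi, - psi''>] is computed edge by edge.  If [w' + w^2 = s^2], then
    [|psi'|^2 + s^2 |psi|^2 - (w |psi|^2)' = |psi' - w psi|^2 >= 0].  On an internal
    edge of length [l] take [w x = s tanh (s (x - l / 2))], on an external edge take
    [w = - s]; integrating bounds
    [<psi, - psi''> + s^2 |psi|^2] from below by the boundary form
    [<psi_, psi'_>] plus [s tanh (amin s / 2) |psi_|^2].  The boundary conditions turn
    the boundary form into [- <psi_, L psi_> >= - |L_+| |psi_|^2], which is absorbed by
    the choice of [s].

    Integration by parts is replaced by one monotonicity principle: an absolutely
    continuous function with nonnegative derivative almost everywhere is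
    nondecreasing.  Applied to [x |-> int_a^x f - F x] it compares [F b - F a] with
    the integral of any integrable [f] that dominates [F'] almost everywhere. *)
Require Import Defs.
From HB Require Import structures.
From mathcomp Require Import all_boot all_order all_algebra.
From mathcomp Require Import all_classical all_reals all_analysis.
From mathcomp Require Import measurable_realfun.
From mathcomp Require Import complex ring lra.
Set Implicit Arguments.
Unset Strict Implicit.
Unset Printing Implicit Defensive.
Import Order.TTheory GRing.Theory Num.Theory.
Import numFieldNormedType.Exports.
Local Open Scope classical_set_scope.
Local Open Scope ring_scope.

(** * Absolutely continuous functions *)

(** The supremum [c] of the points where [P] holds satisfies [P] by the left step, and the right
    step would pass beyond [c] if [c < b]. *)
Lemma creeping (R : realType) (a b : R) (P : R -> Prop) : a <= b -> P a ->
  (forall c, a <= c <= b -> exists2 r, 0 < r &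
     (forall y, a <= y <= c -> c - r < y -> P y -> P c) /\
     (forall y, c <= y <= b -> y < c + r -> P c -> P y)) ->
  P b.
Proof.
move=> ab Pa step.
pose S := [set x | a <= x <= b /\ P x].
have Sa : S a by split=> //; rewrite lexx ab.
have supS : has_sup S.
  by split; [exists a | exists b => x [/andP[]]].
pose c := sup S.
have acb : a <= c <= b.
  rewrite (ub_le_sup supS.2 Sa) /=.
  by apply: ge_sup; [exists a | move=> x [/andP[]]].
have [r r0 [left_step right_step]] := step c acb.
have [y Sy cry] := @sup_adherent _ S r r0 supS.
have Pc : P c.
  case: (Sy) => /andP[ay yb] Py; apply: (left_step y) => //.
  by rewrite ay (ub_le_sup supS.2 Sy).
have {acb} /andP[ac cb] := acb.
have [bc|bc] := leP b c.
  by have -> : b = c by apply/eqP; rewrite eq_le bc.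
exfalso.
pose y' := Num.min b (c + r / 2).
have cy' : c < y' by rewrite lt_min bc ltrDl divr_gt0.
have : S y'.
  split; first by rewrite (le_trans ac (ltW cy')) ge_min lexx.
  apply: right_step => //; first by rewrite (ltW cy') ge_min lexx.
  by rewrite gt_min; apply/orP; right; lra.
by move/(ub_le_sup supS.2); rewrite leNgt cy'.
Qed.

(** Real counterpart of [abs_cont_on], meant for real and imaginary parts, where monotonicity makes
    sense. *)
Definition ac_real (R : realType) (a b : R) (F : R -> R) : Prop :=
  forall eps : R, 0 < eps -> exists2 delta : R, 0 < delta &
    forall (m : nat) (x y : 'I_m -> R),
      (forall k, a <= x k /\ x k <= y k /\ y k <= b) ->
      (forall k l, k != l -> y k <= x l \/ y l <= x k) ->
      \sum_(k < m) (y k - x k) < delta ->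
      \sum_(k < m) `|F (y k) - F (x k)| < eps.

(** Lists replace indexed families because the creeping argument adds intervals one at a time, the
    newest and rightmost at the head. *)
Lemma ac_real_chain (R : realType) (a b : R) (F : R -> R) : ac_real a b F ->
  forall eps : R, 0 < eps -> exists2 delta : R, 0 < delta &
    forall t : seq (R * R),
      pairwise (fun p q => q.2 <= p.1) t ->
      (forall p, p \in t -> [/\ a <= p.1, p.1 <= p.2 & p.2 <= b]) ->
      \sum_(p <- t) (p.2 - p.1) < delta ->
      \sum_(p <- t) `|F p.2 - F p.1| < eps.
Proof.
move=> acF eps eps0; have [d d0 H] := acF eps eps0; exists d => // t pt tab.
rewrite !(big_nth (0, 0)) !big_mkord => td.
apply: (H (size t) (fun k => (nth (0, 0) t k).1) (fun k => (nth (0, 0) t k).2)) => //.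
  by move=> k; have [] := tab _ (mem_nth (0, 0) (ltn_ord k)).
move=> k l kl; have [klt|lkt|/val_inj kle] := ssrnat.ltngtP k l.
- right; exact: (pairwiseP (0,0) pt _ _ (ltn_ord k) (ltn_ord l) klt).
- left; exact: (pairwiseP (0,0) pt _ _ (ltn_ord l) (ltn_ord k) lkt).
- by rewrite kle eqxx in kl.
Qed.

(* Cover the exceptional null set by an open set [U] of small measure and creep from
   [a] to [b]: inside [U] collect the interval just crossed, outside [U] use the
   derivative, losing slope [eta].  Absolute continuity makes the total variation
   over the collected intervals small. *)
Lemma ac_nondecreasing (R : realType) (a b : R) (F : R -> R) : a <= b ->
  ac_real a b F ->
  {ae (@lebesgue_measure R), forall x, a < x < b ->
     exists2 l, 0 <= l & is_derive x 1 F l} ->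
  F a <= F b.
Proof.
move=> ab acF [M [mM M0 subM]].
pose N : set R := M.
have mN : measurable N by exact: mM.
have N0 : lebesgue_measure N = 0%E by exact: M0.
apply/ler_addgt0Pr => e e0.
(* The total loss [eta * (b - a)] stays below [e / 2]; the added [1] avoids a zero denominator when
   [a = b]. *)
pose eta := e / 2 / (b - a + 1).
have ba1 : 0 < b - a + 1 by lra.
have eta0 : 0 < eta by rewrite !divr_gt0.
have e20 : 0 < e / 2 by rewrite divr_gt0.
have [d d0 Hd] := ac_real_chain acF e20.
(* The end points join the null set, so that a point of [[a, b]] outside [U] is interior and has a
   derivative. *)
pose N' := N `|` [set a; b].
have mN' : measurable N' by apply: measurableU => //; apply: measurableU.
have N'0 : lebesgue_measure N' = 0%E.
  have ab0 : (@lebesgue_measure R) [set a; b] = 0%E.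
    by rewrite measureU0 //; exact: lebesgue_measure_set1.
  by rewrite measureU0 //; exact: measurableU.
have N'oo : (lebesgue_measure N' < +oo)%E by rewrite N'0.
have [U [oU NU UNd]] := lebesgue_regularity_outer mN' N'oo d0.
have mU : measurable U by exact: measurable_realfun.open_measurable.
have Ud : (lebesgue_measure U < d%:E)%E.
  apply: le_lt_trans UNd.
  rewrite -[X in (lebesgue_measure X <= _)%E](setDKU NU).
  by rewrite measureU0 //; exact: measurableD.
(* Invariant at [x]: [t] lists the intervals crossed inside [U] so far. The measure of [U] bounds
   their total length, and thereby their total variation. *)
pose P x := exists t : seq (R * R),
  [/\ pairwise (fun p q => q.2 <= p.1) t,
      forall p, p \in t -> [/\ a <= p.1, p.1 <= p.2 & p.2 <= x],
      ((\sum_(p <- t) (p.2 - p.1))%:E <= lebesgue_measure (U `&` `[a, x]%classic))%E &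
      F a <= F x + eta * (x - a) + \sum_(p <- t) `|F p.2 - F p.1|].
have slope_step x y : a <= x -> x <= y -> F x <= F y + eta * (y - x) -> P x -> P y.
  move=> ax xy Fxy [t [pt tx tU Ft]]; exists t; split => //.
  - by move=> p /tx [? ? px]; split => //; exact: le_trans xy.
  - apply: (le_trans tU); apply: le_measure; rewrite ?inE; try exact: measurableI.
    by apply: setIS; apply: subset_itvl; rewrite bnd_simp.
  - nra.
have cover_step x y : a <= x -> x <= y -> `[x, y] `<=` U -> P x -> P y.
  move=> ax xy xyU [t [pt tx tU Ft]]; exists ((x, y) :: t); split => //.
  - by rewrite /= pt andbT; apply/allP => p /tx [].
  - move=> p; rewrite inE => /orP[/eqP -> //|/tx [? ? px]].
    by split => //; exact: le_trans xy.
  - rewrite big_cons /= addrC EFinD.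
    (* The new piece is taken half-open to be disjoint from [[a, x]]. *)
    have -> : U `&` `[a, y] = (U `&` `[a, x]) `|` `]x, y].
      have -> : `]x, y]%classic = U `&` `]x, y].
        by rewrite setIidr //; apply: subset_trans xyU; apply: subset_itv_oc_cc.
      by rewrite -setIUr -itv_bndbnd_setU ?bnd_simp.
    rewrite measureU //; last 2 first.
    + exact: measurableI.
    + apply/disj_set2P; apply/disj_setPS => z [[_ /=]].
      by rewrite !in_itv /= => /andP[_ zx] /andP[xz _]; have := lt_le_trans xz zx; rewrite ltxx.
    + apply: leeD; first exact: tU.
      have : ((y - x)%:E <= lebesgue_measure (`]x, y]%classic : set R))%E.
        rewrite lebesgue_measure_itv /= lte_fin.
        by case: ltgtP xy => // -> _; rewrite subrr.
      by [].
  - rewrite big_cons /=; have := ler_norm (F x - F y); rewrite distrC => ?.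
    have : 0 <= eta * (y - x) by rewrite mulr_ge0 ?subr_ge0 // ltW.
    nra.
have Pb : P b.
  apply: (@creeping _ a b) => //.
    exists [::]; split => //; first by rewrite big_nil.
    by rewrite big_nil subrr mulr0 !addr0.
  move=> c acb.
  (* In the open set [U] a whole neighbourhood of [c] is crossed by [cover_step]; outside, the
     derivative at [c] is nonnegative and [slope_step] applies. *)
  have [Uc|Uc] := pselect (U c).
    have /nbhs_ballP[r /= r0 rU] : nbhs c U by exact: open_nbhs_nbhs.
    exists r => //; split=> y /andP[? ?] ?; apply: cover_step => //.
    - move=> z /=; rewrite in_itv /= => /andP[? ?]; apply: rU => /=.
      by rewrite /ball /= ger0_norm; lra.
    - by move: acb => /andP[].
    - move=> z /=; rewrite in_itv /= => /andP[? ?]; apply: rU => /=.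
      by rewrite /ball /= distrC ger0_norm; lra.
  have N'c : ~ N' c by move/NU.
  have acb' : a < c < b.
    move/andP: acb => [ac cb]; rewrite !lt_neqAle ac cb !andbT.
    by apply/andP; split; apply/eqP => E; apply: N'c; right; [left|right].
  have [l l0 Fl] : exists2 l, 0 <= l & is_derive c 1 F l.
    apply: contrapT => nFl; apply: N'c; left; apply: subM => /=.
    by move/(_ acb').
  have {Fl} : h^-1 *: (F (h *: 1 + c) - F c) @[h --> 0^'] --> l.
    by case: Fl => dF <-; exact: dF.
  move=> /cvgrPdist_lt /(_ _ eta0) /nbhs_ballP [r /= r0 Hr].
  exists r => //; split=> y /andP[ay yb] cy; apply: slope_step => //.
  - have [->|yc] := eqVneq y c; first by rewrite subrr mulr0 addr0.
    have yc0 : y - c < 0 by rewrite subr_lt0 lt_neqAle yc.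
    have := Hr (y - c).
    rewrite /ball /= sub0r normrN ler0_norm ?(ltW yc0) //.
    have -> : - (y - c) < r by lra.
    rewrite (lt_eqF yc0) => /(_ erefl erefl).
    rewrite /GRing.scale /= mulr1 subrK ltr_norml => /andP[_].
    rewrite ltrBlDl -ltrBlDr => H.
    (* Left of [c] the factor [y - c] is negative, so the lower bound on the difference quotient
       becomes an upper bound on the increment. *)
    have : (l - eta) * (y - c) >= F y - F c.
      by rewrite -ler_ndivlMr //; rewrite mulrC ltW.
    nra.
  - by move: acb => /andP[].
  - have [->|yc] := eqVneq y c; first by rewrite subrr mulr0 addr0.
    have yc0 : 0 < y - c by rewrite subr_gt0 lt_neqAle eq_sym yc.
    have := Hr (y - c).
    rewrite /ball /= sub0r normrN ger0_norm ?(ltW yc0) //.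
    have -> : (y - c) < r by lra.
    rewrite (gt_eqF yc0) => /(_ erefl erefl).
    rewrite /GRing.scale /= mulr1 subrK ltr_norml => /andP[_].
    rewrite ltrBlDl -ltrBlDr => H.
    have : (l - eta) * (y - c) <= F y - F c.
      by rewrite -ler_pdivlMr //; rewrite mulrC ltW.
    nra.
have [t [pt tx tU Ft]] := Pb.
have {}Hd := Hd t pt tx.
have {}tU : \sum_(p <- t) (p.2 - p.1) < d.
  rewrite -lte_fin; apply: le_lt_trans tU _; apply: le_lt_trans Ud.
  by apply: le_measure; rewrite ?inE //; exact: measurableI.
have {}Hd := Hd tU.
have : eta * (b - a) <= e / 2.
  rewrite /eta -mulrA ler_piMr ?(ltW e20) // mulrC ler_pdivrMr //; lra.
lra.
Qed.

(** * Closure properties of absolute continuity *)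

(** One comparison of increments serves sums, negatives, products and Lipschitz functions: a common
    [delta] makes the variations of [F] and [G] small together. *)
Lemma ac_real_dominated (R : realType) (a b K : R) (F G H : R -> R) :
  ac_real a b F -> ac_real a b G ->
  (forall x y, a <= x -> x <= y -> y <= b ->
     `|H y - H x| <= K * (`|F y - F x| + `|G y - G x|)) ->
  ac_real a b H.
Proof.
move=> acF acG HK e e0.
pose K' := `|K| + 1.
have K'0 : 0 < K' by rewrite /K' ltr_wpDl.
have e'0 : 0 < e / K' / 2 by rewrite !divr_gt0.
have [d d0 Fd] := acF _ e'0; have [d' d'0 Gd] := acG _ e'0.
exists (Num.min d d') => [|m x y xy dis]; first by rewrite lt_min d0.
rewrite lt_min => /andP[/(Fd _ _ _ xy dis) {}Fd /(Gd _ _ _ xy dis) {}Gd].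
apply: (@le_lt_trans _ _ (K' * \sum_(k < m) (`|F (y k) - F (x k)| + `|G (y k) - G (x k)|))).
  rewrite mulr_sumr; apply: ler_sum => k _.
  have [ax [xyk yb]] := xy k.
  apply: le_trans (HK _ _ ax xyk yb) _; apply: ler_wpM2r; first exact: addr_ge0.
  by rewrite /K' (le_trans (ler_norm _)) // lerDl.
rewrite mulrC -ltr_pdivlMr // big_split /=; lra.
Qed.

Lemma ac_realS (R : realType) (a b a' b' : R) (F : R -> R) :
  a <= a' -> b' <= b -> ac_real a b F -> ac_real a' b' F.
Proof.
move=> aa bb acF e e0; have [d d0 Fd] := acF e e0; exists d => // m x y xy.
by apply: Fd => k; have [ax [? yb]] := xy k; split; [exact: le_trans ax|split => //; exact: le_trans bb].
Qed.

Lemma ac_real_id (R : realType) (a b : R) : ac_real a b (fun x => x).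
Proof.
move=> e e0; exists e => // m x y xy _; apply: le_lt_trans.
by apply: ler_sum => k _; rewrite ger0_norm // subr_ge0; case: (xy k) => _ [].
Qed.

Lemma ac_realD (R : realType) (a b : R) (F G : R -> R) :
  ac_real a b F -> ac_real a b G -> ac_real a b (fun x => F x + G x).
Proof.
move=> acF acG; apply: (ac_real_dominated (K := 1) acF acG) => x y _ _ _.
by rewrite mul1r opprD addrACA; exact: ler_normD.
Qed.

Lemma ac_realN (R : realType) (a b : R) (F : R -> R) :
  ac_real a b F -> ac_real a b (fun x => - F x).
Proof.
move=> acF; apply: (ac_real_dominated (K := 1) acF acF) => x y _ _ _.
by rewrite mul1r -opprD normrN lerDl.
Qed.

Lemma ac_realB (R : realType) (a b : R) (F G : R -> R) :
  ac_real a b F -> ac_real a b G -> ac_real a b (fun x => F x - G x).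
Proof. by move=> acF /ac_realN; exact: ac_realD. Qed.

(** With the [delta] for [eps = 1], a bound grows by at most [1] over a short step, so boundedness
    creeps from [a] to [b]. *)
Lemma ac_real_bounded (R : realType) (a b : R) (F : R -> R) : a <= b ->
  ac_real a b F -> exists M, forall x, a <= x <= b -> `|F x| <= M.
Proof.
move=> ab acF; have [d d0 Fd] := acF 1 ltr01.
have osc x y : a <= x -> x <= y -> y <= b -> y - x < d -> `|F y - F x| < 1.
  move=> ax xy yb xyd.
  have := Fd 1%N (fun=> x) (fun=> y); rewrite !big_ord1; apply => //.
  by move=> k l; rewrite !ord1.
apply: (creeping (a := a) (b := b)
  (P := fun b => exists M, forall x, a <= x <= b -> `|F x| <= M)) => //.
  exists `|F a| => x /andP[ax xa].
  by have -> : x = a by apply/eqP; rewrite eq_le ax xa.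
move=> c /andP[ac cb].
have extend y z : a <= y -> y <= z -> z <= b -> z - y < d ->
   (exists M, forall x, a <= x <= y -> `|F x| <= M) ->
   exists M, forall x, a <= x <= z -> `|F x| <= M.
  move=> ay yz zb zyd [M HM]; exists (M + 1) => x /andP[ax xz].
  have [xy|yx] := leP x y; first by have := HM x; rewrite ax xy => /(_ erefl); lra.
  have : `|F x - F y| < 1.
    by apply: osc => //; [exact: ltW | exact: le_trans zb | lra].
  have := HM y; rewrite ay lexx => /(_ erefl).
  have := ler_normD (F x - F y) (F y); rewrite subrK; lra.
exists d => //; split=> y /andP[? ?] ?; apply: extend => //; lra.
Qed.

Lemma ac_realM (R : realType) (a b : R) (F G : R -> R) : a <= b ->
  ac_real a b F -> ac_real a b G -> ac_real a b (fun x => F x * G x).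
Proof.
move=> ab acF acG.
have [M HM] := ac_real_bounded ab acF; have [N HN] := ac_real_bounded ab acG.
apply: (ac_real_dominated (K := M + N) acF acG) => x y ax xy yb.
have -> : F y * G y - F x * G x = F y * (G y - G x) + (F y - F x) * G x by ring.
apply: le_trans (ler_normD _ _) _; rewrite !normrM.
have : `|F y| <= M by apply: HM; rewrite yb (le_trans ax).
have : `|G x| <= N by apply: HN; rewrite ax (le_trans xy).
have := normr_ge0 (F y); have := normr_ge0 (G x).
have := normr_ge0 (G y - G x); have := normr_ge0 (F y - F x).
nra.
Qed.

Lemma ac_real_lipschitz (R : realType) (a b K : R) (F : R -> R) :
  (forall x y, a <= x -> x <= y -> y <= b -> `|F y - F x| <= K * (y - x)) ->
  ac_real a b F.
Proof.
move=> FK; apply: (ac_real_dominated (K := K / 2) (ac_real_id a b) (ac_real_id a b)).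
by move=> x y ax xy yb; rewrite [in leRHS]ger0_norm ?subr_ge0 //; have := FK x y ax xy yb; lra.
Qed.

(** * Integrals as functions of their upper limit *)

(** Absolute continuity of the integral as a set function, applied to the union of the intervals []x
    k, y k]], which are disjoint because they are half-open. *)
Lemma ac_real_integral (R : realType) (a b : R) (f : R -> R) :
  (@lebesgue_measure R).-integrable setT (EFin \o f) ->
  ac_real a b (fun x => \int[@lebesgue_measure R]_(t in `[a, x]) f t).
Proof.
move=> intf e e0; have [d [d0 fd]] := integral_normr_continuous intf e0.
exists d => // m x y xy dis xyd.
pose I (k : 'I_m) : set R := `]x k, y k]%classic.
have mI k : measurable (I k) by exact: measurable_itv.
have tI : trivIset setT I.
  apply/trivIsetP => k l _ _ kl; apply/seteqP; split => // z [] /=.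
  rewrite /I /= !in_itv /= => /andP[xz zy] /andP[xz' zy'].
  by case: (dis k l kl) => ?; lra.
have muI k : lebesgue_measure (I k) = (y k - x k)%:E.
  have [_ [xyk _]] := xy k.
  rewrite /I lebesgue_measure_itv /= lte_fin.
  by case: ltgtP xyk => // -> _; rewrite subrr.
have mD : measurable (\big[setU/set0]_(k < m) I k) by exact: bigsetU_measurable.
have intS (A : set R) : measurable A -> lebesgue_measure.-integrable A (EFin \o f).
  by move=> mA; apply: integrableS intf.
apply: le_lt_trans (fd _ mD _); last first.
  rewrite measure_bigsetU_ord //.
  rewrite (eq_bigr (fun k => (y k - x k)%:E)) => [|k _]; last exact: muI.
  by rewrite sumEFin lte_fin.
rewrite /Rintegral ge0_integral_bigsetU ?index_enum_uniq //; last 2 first.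
- by apply: sub_trivIset tI.
- apply/measurable_EFinP; apply: measurableT_comp => //.
  by have /integrableP[/measurable_EFinP] := intS _ mD.
rewrite -EFin_sum_fine /=; last first.
  move=> k _; apply: (integrable_fin_num _ (integrable_norm (intS _ (mI k)))).
  exact: mI.
apply: ler_sum => k _; have [ax [xyk yb]] := xy k.
rewrite Rintegral_itvB; last 3 first.
- exact: intS.
- by rewrite bnd_simp.
- by rewrite bnd_simp.
by apply: le_normr_Rintegral => //; exact: intS.
Qed.

Lemma is_derive_derive1 (R : realType) (F : R -> R) (x l : R) :
  derivable F x 1 -> derive1 F x = l -> is_derive x 1 F l.
Proof. by move=> dF <-; rewrite derive1E; exact: DeriveDef. Qed.

Lemma ae_is_derive_integral (R : realType) (a : R) (f : R -> R) :
  (@lebesgue_measure R).-integrable setT (EFin \o f) ->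
  {ae (@lebesgue_measure R), forall x, a < x ->
    is_derive x 1 (fun x => \int[@lebesgue_measure R]_(t in `[a, x]) f t) (f x)}.
Proof.
move=> intf.
have intS y : lebesgue_measure.-integrable [set` Interval (BLeft a) (BRight y)] (EFin \o f).
  by apply: integrableS intf.
have := FTC1 intS (open_integrable_locally openT intf).
apply: (@filterS _ _ (ae_filter_ringOfSetsType (@lebesgue_measure R))) => x H ax.
by have [dF dFE] := H ax; exact: is_derive_derive1.
Qed.

Lemma ac_le_integral (R : realType) (a b : R) (F f : R -> R) : a <= b ->
  (@lebesgue_measure R).-integrable `[a, b] (EFin \o f) ->
  ac_real a b F ->
  {ae (@lebesgue_measure R), forall x, a < x < b ->
     exists2 l, l <= f x & is_derive x 1 F l} ->
  F b - F a <= \int[@lebesgue_measure R]_(t in `[a, b]) f t.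
Proof.
move=> ab intf acF dF.
(* Extension by zero makes the integrand integrable on the whole line, as the two preceding facts
   about integrals require. *)
pose g := f \_ `[a, b].
have intg : lebesgue_measure.-integrable setT (EFin \o g).
  rewrite /g -restrict_EFin.
  by apply: (iffLR (integrable_mkcond _ _)); [exact: measurable_itv|exact: intf].
pose G x := \int[@lebesgue_measure R]_(t in `[a, x]) g t.
have -> : \int[@lebesgue_measure R]_(t in `[a, b]) f t = G b.
  by apply: eq_Rintegral => x /set_mem xab; rewrite /g patchE mem_set.
suff : G a - F a <= G b - F b.
  have -> : G a = 0 by rewrite /G set_itv1 Rintegral_set1.
  lra.
apply: (ac_nondecreasing (F := fun x => G x - F x)) => //.
  by apply: ac_realB => //; exact: ac_real_integral.
have dG := ae_is_derive_integral a intg.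
move: dF dG; apply: (@filterS2 _ _ (ae_filter_ringOfSetsType (@lebesgue_measure R))) => x dF dG /andP[ax xb].
have [l lf Fl] : exists2 l, l <= f x & is_derive x 1 F l by apply: dF; rewrite ax.
have {}dG := dG ax.
exists (g x - l); last exact: is_deriveB.
by rewrite subr_ge0 /g patchE mem_set //= in_itv /= !ltW.
Qed.

(** * Tails of integrals *)

Lemma ge0_subset_Rintegral (d : measure_display) (T : measurableType d) (R : realType)
    (mu : {measure set T -> \bar R}) (A B : set T) (f : T -> R) :
  measurable A -> measurable B -> A `<=` B -> (forall x, B x -> 0 <= f x) ->
  mu.-integrable B (EFin \o f) ->
  \int[mu]_(x in A) f x <= \int[mu]_(x in B) f x.
Proof.
move=> mA mB AB f0 intf; apply: fine_le.
- by apply: integrable_fin_num => //; exact: integrableS intf.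
- exact: integrable_fin_num.
- by apply: ge0_subset_integral => //; case/integrableP: intf.
Qed.

Lemma le_Rintegral_itv_norm (R : realType) (f : R -> R) (c b : R) : 0 <= c ->
  (@lebesgue_measure R).-integrable `[0, +oo[ (EFin \o f) ->
  \int[@lebesgue_measure R]_(t in `[c, b]) f t <=
  \int[@lebesgue_measure R]_(t in `[0, +oo[) `|f t|.
Proof.
move=> c0 intf.
have sub : `[c, b]%classic `<=` (`[0, +oo[%classic : set R).
  by move=> x /=; rewrite !in_itv /= andbT => /andP[/(le_trans c0)].
have intcb : lebesgue_measure.-integrable `[c, b] (EFin \o f).
  by apply: integrableS intf => //; exact: measurable_itv.
apply: le_trans (ler_norm _) _; apply: le_trans (le_normr_Rintegral _ intcb) _.
  exact: measurable_itv.
apply: ge0_subset_Rintegral => //; [exact: measurable_itv..|exact: integrable_norm].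
Qed.

(** The integrals of [|f|] over [F n] converge to that over the union; a remainder below [e] bounds
    the integral over every [A] outside [F n]. *)
Lemma Rintegral_tail (d : measure_display) (T : measurableType d) (R : realType)
    (mu : {measure set T -> \bar R}) (F : (set T)^nat) (f : T -> R) (e : R) :
  nondecreasing_seq F -> (forall n, measurable (F n)) ->
  mu.-integrable (\bigcup_n F n) (EFin \o f) -> 0 < e ->
  exists n, forall A, measurable A -> A `<=` (\bigcup_n F n) `\` F n ->
    `|\int[mu]_(x in A) f x| < e.
Proof.
move=> ndF mF intf e0.
pose D := \bigcup_n F n.
have mD : measurable D by exact: bigcup_measurable.
have FD n : F n `<=` D by exact: bigcup_sup.
have intS A : measurable A -> A `<=` D -> mu.-integrable A (EFin \o f).
  by move=> mA AD; apply: integrableS intf.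
have intn := integrable_norm intf.
have cF : ((\int[mu]_(t in F n) `|f t|)%:E @[n --> \oo] -->
    (\int[mu]_(t in D) `|f t|)%:E)%E.
  rewrite fineK; last exact: integrable_fin_num.
  rewrite (_ : (fun n => _) = (fun n => \int[mu]_(t in F n) `|f t|%:E)%E); last first.
    apply/funext => n; rewrite fineK //; apply: integrable_fin_num => //.
    by apply: integrable_norm; exact: intS.
  apply: ge0_nondecreasing_set_cvg_integral => // n.
  by case/integrableP: (integrable_norm (intS _ (mF n) (FD n))).
move/fine_cvgP: cF => [_ /cvgrPdist_lt /(_ _ e0) [n _ /(_ n (leqnn n)) Hn]].
exists n => A mA AF.
have AD : A `<=` D by move=> x /AF [].
apply: le_lt_trans (le_normr_Rintegral mA (intS _ mA AD)) _.
apply: le_lt_trans Hn; apply: le_trans (ler_norm _) => /=.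
rewrite lerBrDr -Rintegral_setU //.
- apply: ge0_subset_Rintegral => //; first exact: measurableU.
  by move=> x [/AD|/FD].
- apply: integrable_norm; apply: intS; first exact: measurableU.
  by move=> x [/AD|/FD].
- by apply/disj_setPS => x [/AF []].
Qed.

(** The half-line is exhausted by the intervals [[0, n]]; for [b >= n] the difference is the
    integral over []b, +oo[], which avoids [[0, n]]. *)
Lemma Rintegral_itv_cvgy (R : realType) (f : R -> R) (e : R) : 0 < e ->
  (@lebesgue_measure R).-integrable `[0, +oo[ (EFin \o f) ->
  exists2 c, 0 <= c & forall b, c <= b ->
    `|\int[@lebesgue_measure R]_(t in `[0, +oo[) f t -
      \int[@lebesgue_measure R]_(t in `[0, b]) f t| < e.
Proof.
move=> e0 intf.
pose I n : set R := `[0, n%:R]%classic.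
have Iy : \bigcup_n I n = (`[0, +oo[%classic : set R).
  by rewrite itv_bndy_bigcup_BRight; apply: eq_bigcup => // n _; rewrite /I add0r.
have [||| n Hn] := @Rintegral_tail _ _ R (@lebesgue_measure R) I f e _ _ _ e0.
- move=> m n mn; apply/subsetPset; apply: subset_itvl.
  by rewrite bnd_simp ler_nat.
- by move=> n; exact: measurable_itv.
- by rewrite Iy; exact: intf.
exists n%:R => // b nb.
rewrite Rintegral_itvB //; last by rewrite bnd_simp (le_trans _ nb).
apply: Hn; first exact: measurable_itv.
rewrite Iy => x /=; rewrite !in_itv /= !andbT => bx; split.
  by rewrite (le_trans _ (ltW bx)) // (le_trans _ nb).
by rewrite /I /= in_itv /= => /andP[_]; rewrite leNgt (le_lt_trans nb bx).
Qed.

(** * Functions on one edge *)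

(** Measurability of [f] is a separate clause because it does not follow from that of its square. *)
Definition sq_integrable (d : measure_display) (T : measurableType d) (R : realType)
    (mu : {measure set T -> \bar R}) (D : set T) (f : T -> R) : Prop :=
  measurable_fun D f /\ mu.-integrable D (EFin \o (fun x => f x ^+ 2)).

(** Since [(|f| - |g|)^2 >= 0], the product is dominated by [f^2 + g^2]. *)
Lemma sq_integrable_mul (d : measure_display) (T : measurableType d) (R : realType)
    (mu : {measure set T -> \bar R}) (D : set T) (f g : T -> R) : measurable D ->
  sq_integrable mu D f -> sq_integrable mu D g ->
  mu.-integrable D (EFin \o (fun x => f x * g x)).
Proof.
move=> mD [mf intf] [mg intg].
apply: (le_integrable mD _ _ (integrableD mD intf intg)).
  by apply/measurable_EFinP; exact: measurable_funM.
move=> x _ /=; rewrite lee_fin normrM.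
rewrite [leRHS]ger0_norm ?addr_ge0 ?sqr_ge0 //.
have := sqr_ge0 (`|f x| - `|g x|).
rewrite -(real_normK (num_real (f x))) -(real_normK (num_real (g x))).
have := normr_ge0 (f x); have := normr_ge0 (g x); nra.
Qed.

Lemma normc_sqrE (R : realType) (z : R[i]) :
  ComplexField.Normc.normc z ^+ 2 = complex.Re z ^+ 2 + complex.Im z ^+ 2.
Proof. by case: z => x y /=; rewrite sqr_sqrtr // addr_ge0 ?sqr_ge0. Qed.

Lemma le_normr_Re (R : realType) (z : R[i]) :
  `|complex.Re z| <= ComplexField.Normc.normc z.
Proof.
case: z => x y /=; rewrite -sqrtr_sqr ler_sqrt ?lerDl ?sqr_ge0 //.
by rewrite addr_ge0 ?sqr_ge0.
Qed.

Lemma le_normr_Im (R : realType) (z : R[i]) :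
  `|complex.Im z| <= ComplexField.Normc.normc z.
Proof.
case: z => x y /=; rewrite -sqrtr_sqr ler_sqrt ?lerDr ?sqr_ge0 //.
by rewrite addr_ge0 ?sqr_ge0.
Qed.

Lemma divc_RtoC (R : realType) (z : R[i]) (r : R) :
  z / RtoC r = Complex (complex.Re z / r) (complex.Im z / r).
Proof.
have -> : (RtoC r)^-1 = RtoC r^-1 by rewrite [RHS](fmorphV (real_complex R)).
by case: z => x y; apply/eqP; rewrite eq_complex /= !mulr0 subr0 add0r !eqxx.
Qed.

Lemma is_derive_epsilon (R : realType) (F : R -> R) (x l : R) :
  (forall e, 0 < e -> exists2 d, 0 < d & forall y, y != x -> `|y - x| < d ->
     `|(F y - F x) / (y - x) - l| < e) ->
  is_derive x 1 F l.
Proof.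
move=> Fl.
have cF : h^-1 *: (F (h *: 1 + x) - F x) @[h --> 0^'] --> l.
  apply/cvgrPdist_lt => e e0; have [d d0 Hd] := Fl e e0.
  apply/nbhs_ballP; exists d => //= h; rewrite /ball /= sub0r normrN => hd h0.
  have := Hd (h + x); rewrite -subr_eq0 addrK h0 => /(_ erefl hd).
  by rewrite /GRing.scale /= mulr1 distrC mulrC.
split; first by apply/cvg_ex; exists l.
exact: cvg_lim.
Qed.

Lemma has_deriv_Re (R : realType) (f : R -> R[i]) (x : R) (l : R[i]) :
  has_deriv f x l -> is_derive x 1 (fun y => complex.Re (f y)) (complex.Re l).
Proof.
move=> fl; apply: is_derive_epsilon => e /fl [d d0 Hd]; exists d => // y yx yd.
apply: le_lt_trans (Hd y yx yd); rewrite divc_RtoC.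
apply: le_trans (le_normr_Re _).
by case: (f y) => ? ?; case: (f x) => ? ?; case: l {Hd fl}.
Qed.

Lemma has_deriv_Im (R : realType) (f : R -> R[i]) (x : R) (l : R[i]) :
  has_deriv f x l -> is_derive x 1 (fun y => complex.Im (f y)) (complex.Im l).
Proof.
move=> fl; apply: is_derive_epsilon => e /fl [d d0 Hd]; exists d => // y yx yd.
apply: le_lt_trans (Hd y yx yd); rewrite divc_RtoC.
apply: le_trans (le_normr_Im _).
by case: (f y) => ? ?; case: (f x) => ? ?; case: l {Hd fl}.
Qed.

Lemma abs_cont_on_Re (R : realType) (a b : R) (f : R -> R[i]) :
  abs_cont_on a b f -> ac_real a b (fun x => complex.Re (f x)).
Proof.
move=> acf e /acf [d d0 Hd]; exists d => // m x y xy dis xyd.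
apply: le_lt_trans (Hd m x y xy dis xyd); apply: ler_sum => k _.
apply: le_trans (le_normr_Re _).
by case: (f (y k)) => ? ?; case: (f (x k)).
Qed.

Lemma abs_cont_on_Im (R : realType) (a b : R) (f : R -> R[i]) :
  abs_cont_on a b f -> ac_real a b (fun x => complex.Im (f x)).
Proof.
move=> acf e /acf [d d0 Hd]; exists d => // m x y xy dis xyd.
apply: le_lt_trans (Hd m x y xy dis xyd); apply: ler_sum => k _.
apply: le_trans (le_normr_Im _).
by case: (f (y k)) => ? ?; case: (f (x k)).
Qed.

Lemma measurable_edge_set (R : realType) (len : option R) :
  measurable (edge_set len).
Proof. by case: len => [l|]; exact: measurable_itv. Qed.

(** Models the real or imaginary part of a function in the domain, with derivatives [p1] and [p2].
    Asking absolute continuity on each [[0, b]] within the edge treats internal and external edges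
    together. *)
Definition real_edge (R : realType) (len : option R) (p p1 p2 : R -> R) : Prop :=
  [/\ forall b, 0 < b -> edge_set len b -> ac_real 0 b p /\ ac_real 0 b p1,
      {ae (@lebesgue_measure R), forall x, edge_set len x ->
         is_derive x 1 p (p1 x) /\ is_derive x 1 p1 (p2 x)},
      sq_integrable (@lebesgue_measure R) (edge_set len) p &
      sq_integrable (@lebesgue_measure R) (edge_set len) p2].

Lemma L2_edge_sq_integrable (R : realType) (len : option R) (f : R -> R[i]) :
  L2_edge len f ->
  sq_integrable (@lebesgue_measure R) (edge_set len) (fun x => complex.Re (f x)) /\
  sq_integrable (@lebesgue_measure R) (edge_set len) (fun x => complex.Im (f x)).
Proof.
case=> mRe mIm fin.
have mRe2 : measurable_fun (edge_set len) (fun x => complex.Re (f x) ^+ 2).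
  exact: measurable_funX.
have mIm2 : measurable_fun (edge_set len) (fun x => complex.Im (f x) ^+ 2).
  exact: measurable_funX.
have mD := measurable_edge_set len.
have intn : (@lebesgue_measure R).-integrable (edge_set len)
    (EFin \o (fun x => complex.Re (f x) ^+ 2 + complex.Im (f x) ^+ 2)).
  apply/integrableP; split.
    by apply/measurable_EFinP; exact: measurable_funD.
  apply: le_lt_trans fin; rewrite le_eqVlt; apply/orP; left; apply/eqP.
  apply: eq_integral => x _.
  by rewrite /= normc_sqrE ger0_norm // addr_ge0 ?sqr_ge0.
split; split => //; apply: (le_integrable _ _ _ intn).
- exact: mD.
- exact/measurable_EFinP.
- move=> x _ /=; rewrite lee_fin !ger0_norm ?addr_ge0 ?sqr_ge0 //.
  by rewrite lerDl sqr_ge0.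
- exact: mD.
- exact/measurable_EFinP.
- move=> x _ /=; rewrite lee_fin !ger0_norm ?addr_ge0 ?sqr_ge0 //.
  by rewrite lerDr sqr_ge0.
Qed.

Lemma in_D_edge_real (R : realType) (len : option R) (psi dpsi ddpsi : R -> R[i]) :
  in_D_edge len psi dpsi ddpsi ->
  real_edge len (fun x => complex.Re (psi x)) (fun x => complex.Re (dpsi x))
                (fun x => complex.Re (ddpsi x)) /\
  real_edge len (fun x => complex.Im (psi x)) (fun x => complex.Im (dpsi x))
                (fun x => complex.Im (ddpsi x)).
Proof.
case=> /L2_edge_sq_integrable[L2Re L2Im] [acp dp] acdp ddp
  /L2_edge_sq_integrable[L2dRe L2dIm].
have ac b : 0 < b -> edge_set len b ->
    abs_cont_on 0 b psi /\ abs_cont_on 0 b dpsi.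
  case: len acp acdp {dp ddp L2Re L2Im L2dRe L2dIm} => [l|] acp acdp b0 /=.
    rewrite in_itv /= => /andP[_ bl].
    have sub f : abs_cont_on 0 l f -> abs_cont_on 0 b f.
      move=> acf e /acf [d d0 Hd]; exists d => // m x y xy; apply: Hd => k.
      by have [? [? yb]] := xy k; do 2 split => //; exact: le_trans bl.
    by split; apply: sub.
  by move=> _; split; [exact: acp|exact: acdp].
split; split => //.
- by move=> b b0 /(ac _ b0) [? ?]; split; exact: abs_cont_on_Re.
- move: dp ddp; apply: (@filterS2 _ _ (ae_filter_ringOfSetsType (@lebesgue_measure R))).
  by move=> x dp ddp xl; split; apply: has_deriv_Re; [exact: dp|exact: ddp].
- by move=> b b0 /(ac _ b0) [? ?]; split; exact: abs_cont_on_Im.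
- move: dp ddp; apply: (@filterS2 _ _ (ae_filter_ringOfSetsType (@lebesgue_measure R))).
  by move=> x dp ddp xl; split; apply: has_deriv_Im; [exact: dp|exact: ddp].
Qed.

Lemma is_derive_mul (R : realType) (f g : R -> R) (x df dg : R) :
  is_derive x 1 f df -> is_derive x 1 g dg ->
  is_derive x 1 (fun y => f y * g y) (df * g x + f x * dg).
Proof.
move=> fx gx; apply: is_derive_eq (is_deriveM fx gx) _.
by rewrite /GRing.scale /= addrC [g x * df]mulrC.
Qed.

Lemma is_derive_sub (R : realType) (f g : R -> R) (x df dg : R) :
  is_derive x 1 f df -> is_derive x 1 g dg ->
  is_derive x 1 (fun y => f y - g y) (df - dg).
Proof. by move=> fx gx; exact: is_deriveB. Qed.

Lemma is_derive_add (R : realType) (f g : R -> R) (x df dg : R) :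
  is_derive x 1 f df -> is_derive x 1 g dg ->
  is_derive x 1 (fun y => f y + g y) (df + dg).
Proof. by move=> fx gx; exact: is_deriveD. Qed.

Lemma edge_set_itv (R : realType) (len : option R) (b : R) :
  edge_set len b -> `[0, b]%classic `<=` edge_set len.
Proof.
case: len => [l|] /=; rewrite in_itv /= => /andP[b0 bl] x /=; rewrite !in_itv /= => /andP[-> xb] //=.
exact: le_trans bl.
Qed.

Lemma integrable_subr (d : measure_display) (T : measurableType d) (R : realType)
    (mu : {measure set T -> \bar R}) (D : set T) (f g : T -> R) : measurable D ->
  mu.-integrable D (EFin \o f) -> mu.-integrable D (EFin \o g) ->
  mu.-integrable D (EFin \o (fun x => f x - g x)).
Proof. by move=> mD intf intg; exact: (integrableB mD intf intg). Qed.

Lemma integrable_addr (d : measure_display) (T : measurableType d) (R : realType)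
    (mu : {measure set T -> \bar R}) (D : set T) (f g : T -> R) : measurable D ->
  mu.-integrable D (EFin \o f) -> mu.-integrable D (EFin \o g) ->
  mu.-integrable D (EFin \o (fun x => f x + g x)).
Proof. by move=> mD intf intg; exact: (integrableD mD intf intg). Qed.

Lemma integrable_mulrl (d : measure_display) (T : measurableType d) (R : realType)
    (mu : {measure set T -> \bar R}) (D : set T) (k : R) (f : T -> R) : measurable D ->
  mu.-integrable D (EFin \o f) -> mu.-integrable D (EFin \o (fun x => k * f x)).
Proof. by move=> mD intf; exact: (integrableZl mD k intf). Qed.

Lemma integrable_itv_edge (R : realType) (len : option R) (f : R -> R) (a b : R) :
  0 <= a -> edge_set len b ->
  (@lebesgue_measure R).-integrable (edge_set len) (EFin \o f) ->
  (@lebesgue_measure R).-integrable `[a, b] (EFin \o f).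
Proof.
move=> a0 lb intf; apply: integrableS intf.
- exact: measurable_edge_set.
- exact: measurable_itv.
- apply: subset_trans (edge_set_itv lb).
  by move=> x /=; rewrite !in_itv /= => /andP[/(le_trans a0) -> ->].
Qed.

Lemma integrable_real_edge (R : realType) (len : option R) (p p1 p2 q q1 q2 : R -> R) :
  real_edge len p p1 p2 -> real_edge len q q1 q2 ->
  (@lebesgue_measure R).-integrable (edge_set len) (EFin \o (fun x => p x * q x)) /\
  (@lebesgue_measure R).-integrable (edge_set len) (EFin \o (fun x => p x * q2 x)).
Proof.
move=> [_ _ L2p _] [_ _ L2q L2q2].
by split; apply: sq_integrable_mul => //; exact: measurable_edge_set.
Qed.

Lemma real_edge_ac (R : realType) (len : option R) (p p1 p2 : R -> R) (a b : R) :
  real_edge len p p1 p2 -> 0 <= a -> a < b -> edge_set len b ->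
  ac_real a b p /\ ac_real a b p1.
Proof.
move=> [ac _ _ _] a0 ab lb; have [acp acp1] := ac b (le_lt_trans a0 ab) lb.
by split; [apply: ac_realS acp|apply: ac_realS acp1].
Qed.

Lemma real_edge_ae (R : realType) (len : option R) (p p1 p2 q q1 q2 : R -> R) (a b : R) :
  real_edge len p p1 p2 -> real_edge len q q1 q2 -> 0 <= a -> edge_set len b ->
  {ae (@lebesgue_measure R), forall x, a < x < b ->
     [/\ is_derive x 1 p (p1 x), is_derive x 1 p1 (p2 x),
         is_derive x 1 q (q1 x) & is_derive x 1 q1 (q2 x)]}.
Proof.
move=> [_ dp _ _] [_ dq _ _] a0 /edge_set_itv lb; move: dp dq.
apply: (@filterS2 _ _ (ae_filter_ringOfSetsType (@lebesgue_measure R))).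
move=> x dp dq /andP[ax xb].
have lx : edge_set len x.
  by apply: lb => /=; rewrite in_itv /= (ltW xb) andbT (le_trans a0 (ltW ax)).
by have [? ?] := dp lx; have [? ?] := dq lx.
Qed.

(* With [w' + w^2 = s^2] the integrand minus [(w p^2 - p p')'] is the square
   [(p' - w p)^2]. *)
Lemma real_edge_energy (R : realType) (len : option R) (p p1 p2 w : R -> R) (s b : R) :
  real_edge len p p1 p2 -> 0 < b -> edge_set len b -> ac_real 0 b w ->
  (forall x : R, is_derive x 1 w (s ^+ 2 - w x ^+ 2)) ->
  (w b * p b ^+ 2 - p b * p1 b) - (w 0 * p 0 ^+ 2 - p 0 * p1 0) <=
  \int[@lebesgue_measure R]_(t in `[0, b]) (s ^+ 2 * (p t * p t) - p t * p2 t).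
Proof.
move=> ep b0 lb acw dw.
have [acp acp1] := real_edge_ac ep (lexx 0) b0 lb.
have [intpp intpp2] := integrable_real_edge ep ep.
apply: (ac_le_integral (F := fun x => w x * p x ^+ 2 - p x * p1 x)
  (f := fun t => s ^+ 2 * (p t * p t) - p t * p2 t)); first exact: ltW.
- apply: integrable_itv_edge lb _ => //.
  apply: integrable_subr => //; first exact: measurable_edge_set.
  by apply: integrable_mulrl => //; exact: measurable_edge_set.
- apply: ac_realB; last exact: ac_realM (ltW b0) acp acp1.
  by apply: (ac_realM (ltW b0) acw); exact: (ac_realM (ltW b0) acp acp).
- have := real_edge_ae ep ep (lexx 0) lb.
  apply: (@filterS _ _ (ae_filter_ringOfSetsType (@lebesgue_measure R))).
  move=> x H /H [dp dp1 _ _].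
  have dpp := is_derive_mul dp dp.
  have := is_derive_sub (is_derive_mul (dw x) dpp) (is_derive_mul dp dp1).
  set l := (X in is_derive _ _ _ X) => dF; exists l => //.
  (* The integrand exceeds [l] by exactly this square. *)
  have := sqr_ge0 (p1 x - w x * p x); rewrite /l; lra.
Qed.

(** The derivative of [p q' - q p'] is exactly [p q'' - q p''], so the comparison with the integral
    holds in both directions. *)
Lemma real_edge_wronskian (R : realType) (len : option R) (p p1 p2 q q1 q2 : R -> R) (b : R) :
  real_edge len p p1 p2 -> real_edge len q q1 q2 -> 0 < b -> edge_set len b ->
  \int[@lebesgue_measure R]_(t in `[0, b]) (p t * q2 t - q t * p2 t) =
  (p b * q1 b - q b * p1 b) - (p 0 * q1 0 - q 0 * p1 0).
Proof.
(* One inequality suffices: exchanging the two functions changes all signs and yields the other. *)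
suff le p' p1' p2' q' q1' q2' : real_edge len p' p1' p2' -> real_edge len q' q1' q2' ->
    0 < b -> edge_set len b ->
    (p' b * q1' b - q' b * p1' b) - (p' 0 * q1' 0 - q' 0 * p1' 0) <=
    \int[@lebesgue_measure R]_(t in `[0, b]) (p' t * q2' t - q' t * p2' t).
  move=> ep eq b0 lb; apply/eqP; rewrite eq_le le // andbT.
  have [_ intpq] := integrable_real_edge ep eq.
  have [_ intqp] := integrable_real_edge eq ep.
  have intS f := @integrable_itv_edge R len f 0 b (lexx 0) lb.
  have := le _ _ _ _ _ _ eq ep b0 lb.
  have sub f g : (@lebesgue_measure R).-integrable (edge_set len) (EFin \o f) ->
      (@lebesgue_measure R).-integrable (edge_set len) (EFin \o g) ->
      \int[@lebesgue_measure R]_(t in `[0, b]) (f t - g t) =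
      \int[@lebesgue_measure R]_(t in `[0, b]) f t -
      \int[@lebesgue_measure R]_(t in `[0, b]) g t.
    by move=> intf intg; apply: RintegralB; [exact: measurable_itv|exact: intS..].
  have := sub _ _ intpq intqp; have := sub _ _ intqp intpq => /= -> ->; lra.
move=> ep eq b0 lb.
have [acp acp1] := real_edge_ac ep (lexx 0) b0 lb.
have [acq acq1] := real_edge_ac eq (lexx 0) b0 lb.
have [_ intpq] := integrable_real_edge ep eq.
have [_ intqp] := integrable_real_edge eq ep.
apply: (ac_le_integral (F := fun x => p' x * q1' x - q' x * p1' x)
  (f := fun t => p' t * q2' t - q' t * p2' t)); first exact: ltW.
- apply: integrable_itv_edge lb _ => //.
  by apply: integrable_subr => //; exact: measurable_edge_set.
- by apply: ac_realB; apply: ac_realM => //; exact: ltW.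
- have := real_edge_ae ep eq (lexx 0) lb.
  apply: (@filterS _ _ (ae_filter_ringOfSetsType (@lebesgue_measure R))).
  move=> x H /H [dp dp1 dq dq1].
  have := is_derive_sub (is_derive_mul dp dq1) (is_derive_mul dq dp1).
  set l := (X in is_derive _ _ _ X) => dF; exists l => //.
  rewrite /l; lra.
Qed.

Lemma edge_setNone (R : realType) (b : R) : 0 <= b -> edge_set None b.
Proof. by move=> b0; rewrite /= in_itv /= b0. Qed.

(* Otherwise [e <= u + (p')^2 + (q')^2] near infinity, where [u = p^2 + q^2].  As [u]
   and [p p'' + q q''] are integrable, [r = p p' + q q'] grows linearly; since
   [u' = 2 r], so does [u], which contradicts the integrability of [u]. *)
Lemma real_edge_vanishing (R : realType) (p p1 p2 q q1 q2 : R -> R) (e c : R) :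
  real_edge None p p1 p2 -> real_edge None q q1 q2 -> 0 < e -> 0 <= c ->
  exists2 b, c <= b & p b ^+ 2 + q b ^+ 2 + p1 b ^+ 2 + q1 b ^+ 2 < e.
Proof.
move=> ep eq e0 c0; apply: contrapT => nex.
have {nex} large b : c <= b -> e <= p b ^+ 2 + q b ^+ 2 + p1 b ^+ 2 + q1 b ^+ 2.
  by move=> cb; rewrite leNgt; apply/negP => small; apply: nex; exists b.
pose u x := p x * p x + q x * q x.
pose r x := p x * p1 x + q x * q1 x.
pose h x := p x * p2 x + q x * q2 x.
have [intpp intpp2] := integrable_real_edge ep ep.
have [intqq intqq2] := integrable_real_edge eq eq.
have intu : (@lebesgue_measure R).-integrable `[0, +oo[ (EFin \o u).
  by apply: integrable_addr => //; exact: (measurable_edge_set None).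
have inth : (@lebesgue_measure R).-integrable `[0, +oo[ (EFin \o h).
  by apply: integrable_addr => //; exact: (measurable_edge_set None).
have intuh : (@lebesgue_measure R).-integrable `[0, +oo[ (EFin \o (fun x => u x - h x)).
  by apply: integrable_subr => //; exact: (measurable_edge_set None).
have intS f a b : 0 <= a -> a <= b -> (@lebesgue_measure R).-integrable `[0, +oo[ (EFin \o f) ->
    (@lebesgue_measure R).-integrable `[a, b] (EFin \o f).
  by move=> a0 ab; apply: (@integrable_itv_edge _ None) => //; apply: edge_setNone; exact: le_trans ab.
have acs a b : 0 <= a -> a < b ->
    [/\ ac_real a b p, ac_real a b p1, ac_real a b q & ac_real a b q1].
  move=> a0 ab; have lb := edge_setNone (ltW (le_lt_trans a0 ab)).
  by have [? ?] := real_edge_ac ep a0 ab lb; have [? ?] := real_edge_ac eq a0 ab lb.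
pose M := \int[@lebesgue_measure R]_(t in `[0, +oo[) `|u t - h t|.
pose N := \int[@lebesgue_measure R]_(t in `[0, +oo[) `|u t|.
have u0 x : 0 <= u x by rewrite /u -!expr2 addr_ge0 ?sqr_ge0.
(* By [large], the derivative of [e * x - r x] is at most [u x - h x], whose integrals are bounded
   by [M]. *)
have r_growth b : c < b -> e * (b - c) - M + r c <= r b.
  move=> cb; have [acp acp1 acq acq1] := acs c b c0 cb.
  suff : (e * b - r b) - (e * c - r c) <=
      \int[@lebesgue_measure R]_(t in `[c, b]) (u t - h t).
    by have := le_Rintegral_itv_norm b c0 intuh; rewrite -/M; lra.
  apply: (ac_le_integral (F := fun x => e * x - r x) (f := fun x => u x - h x)).
  - exact: ltW.
  - by apply: intS => //; exact: ltW.
  - apply: ac_realB; last by apply: ac_realD; apply: ac_realM => //; exact: ltW.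
    apply: (ac_real_lipschitz (K := e)) => x y _ xy _.
    by rewrite -mulrBr ger0_norm // mulr_ge0 ?subr_ge0 // ltW.
  - have := real_edge_ae ep eq c0 (edge_setNone (ltW (le_lt_trans c0 cb))).
    apply: (@filterS _ _ (ae_filter_ringOfSetsType (@lebesgue_measure R))).
    move=> x H /[dup] /andP[cx _] /H [dp dp1 dq dq1].
    have := is_derive_sub (is_derive_mul (is_derive_cst e x 1) (is_derive_id x 1))
      (is_derive_add (is_derive_mul dp dp1) (is_derive_mul dq dq1)).
    set l := (X in is_derive _ _ _ X) => dF; exists l => //.
    have := large x (ltW cx); rewrite /l /u /h /cst; lra.
(* From [c2] on, [e * (x - c)] is at least [|M| + |r c| + 1], which forces [r x >= 1]. *)
pose c2 := c + (`|M| + `|r c| + 1) / e.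
have cc2 : c < c2.
  by rewrite ltrDl divr_gt0 // ltr_wpDl // addr_ge0.
have r_ge1 x : c2 <= x -> 1 <= r x.
  move=> c2x; apply: le_trans (r_growth x (lt_le_trans cc2 c2x)).
  have : `|M| + `|r c| + 1 <= e * (x - c).
    rewrite -ler_pdivrMl // mulrC; move: c2x; rewrite /c2; lra.
  have := ler_norm M; have := ler_norm (- r c); rewrite normrN; lra.
have c20 : 0 <= c2 by rewrite (le_trans c0 (ltW cc2)).
(* Here [u' = 2 r >= 2], so [u x - x] is nondecreasing. *)
have u_growth b : c2 < b -> b - c2 <= u b.
  move=> cb; have [acp acp1 acq acq1] := acs c2 b c20 cb.
  suff : u c2 - c2 <= u b - b by have := u0 c2; lra.
  apply: (ac_nondecreasing (F := fun x => u x - x)).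
  - exact: ltW.
  - apply: ac_realB; last exact: ac_real_id.
    by apply: ac_realD; apply: ac_realM => //; exact: ltW.
  - have := real_edge_ae ep eq c20 (edge_setNone (ltW (le_lt_trans c20 cb))).
    apply: (@filterS _ _ (ae_filter_ringOfSetsType (@lebesgue_measure R))).
    move=> x H /[dup] /andP[cx _] /H [dp dp1 dq dq1].
    have := is_derive_sub (is_derive_add (is_derive_mul dp dp) (is_derive_mul dq dq))
       (is_derive_id x 1).
    set l := (X in is_derive _ _ _ X) => dF; exists l => //.
    have := r_ge1 x (ltW cx); rewrite /l /r; lra.
(* Beyond [c3] the function [u] is at least [1], so an interval of length [|N| + 1] carries more
   integral than [N] allows. *)
pose c3 := c2 + 1.
pose b := c3 + `|N| + 1.
have c3b : c3 < b by rewrite /b -addrA ltrDl ltr_wpDl.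
have c30 : 0 <= c3 by rewrite addr_ge0.
suff : b - c3 <= \int[@lebesgue_measure R]_(t in `[c3, b]) u t.
  have := le_Rintegral_itv_norm b c30 intu; rewrite -/N.
  by have := ler_norm N; rewrite /b; lra.
apply: (ac_le_integral (F := fun x => x)); first exact: ltW.
- by apply: intS => //; exact: ltW.
- exact: ac_real_id.
- apply: aeW => x /andP[cx _]; exists 1; last exact: is_derive_id.
  by have := u_growth x; move: cx; rewrite /c3; lra.
Qed.

(** * Energy estimates on one edge *)

Lemma is_derive_mvt (R : realType) (F dF : R -> R) (x y : R) : x <= y ->
  (forall z : R, is_derive z 1 F (dF z)) ->
  exists c, F y - F x = dF c * (y - x).
Proof.
move=> xy dFz; have [|c _ H] := MVT_segment xy (fun z _ => dFz z).
- by apply: derivable_within_continuous => z _; case: (dFz z).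
- by exists c.
Qed.

(** * The hyperbolic tangent and the Riccati equation *)

Lemma tanh_lt1 (R : realType) (x : R) : `|tanh x| < 1.
Proof.
have e0 := expR_gt0 x; have e1 := expR_gt0 (- x).
rewrite /tanh normrM (gtr0_norm (x := _^-1)) ?invr_gt0 ?addr_gt0 //.
rewrite ltr_pdivrMr ?addr_gt0 // mul1r ltr_norml; lra.
Qed.

Lemma is_derive_tanh (R : realType) (x : R) :
  is_derive x 1 (@tanh R) (1 - tanh x ^+ 2).
Proof.
pose c (y : R) := expR y + expR (- y).
pose n (y : R) := expR y - expR (- y).
have c0 y : 0 < c y by rewrite addr_gt0 // expR_gt0.
have dN (y : R) : is_derive y 1 (fun z : R => expR (- z)) (- expR (- y)).
  rewrite -[- expR _]mulrN1.
  exact: (@is_derive1_comp R expR -%R y _ _ (is_derive_expR (- y)) (is_deriveNid y 1)).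
have dc := is_derive_add (is_derive_expR x) (dN x).
have dn := is_derive_sub (is_derive_expR x) (dN x).
have dV : is_derive x 1 (fun y => (c y)^-1) (- (c x)^-1 ^+ 2 * n x).
  have cx : c x != 0 by rewrite gt_eqF.
  apply: (is_derive_eq (is_deriveV cx dc)).
  by rewrite /GRing.scale /= exprVn.
apply: (is_derive_eq (is_derive_mul dn dV)).
have cx : c x != 0 by rewrite gt_eqF.
rewrite /tanh -/(c x) -/(n x) opprK -/(c x); by field.
Qed.

Lemma sqr_tanh_le1 (R : realType) (x : R) : tanh x ^+ 2 <= 1.
Proof. have := tanh_lt1 x; rewrite ltr_norml => /andP[]; nra. Qed.

Lemma tanh_le (R : realType) (x y : R) : x <= y -> tanh x <= tanh y.
Proof.
move=> xy; have [c] := is_derive_mvt xy (@is_derive_tanh R).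
by move=> tE; rewrite -subr_ge0 tE mulr_ge0 ?subr_ge0 ?sqr_tanh_le1.
Qed.

Lemma tanhN (R : realType) (x : R) : tanh (- x) = - tanh x.
Proof. by rewrite /tanh opprK -mulNr opprB [expR (- x) + expR x]addrC. Qed.

(** The solution of [w' + w^2 = s^2] that vanishes at [m]; on an internal edge [m] will be the
    midpoint. *)
Lemma is_derive_riccati (R : realType) (s m x : R) :
  is_derive x 1 (fun y => s * tanh (s * (y - m)))
    (s ^+ 2 - (s * tanh (s * (x - m))) ^+ 2).
Proof.
have d1 : is_derive x 1 (fun y => s * (y - m)) s.
  apply: (is_derive_eq (is_derive_mul (is_derive_cst s x 1)
             (is_derive_sub (is_derive_id x 1) (is_derive_cst m x 1)))).
  by rewrite /cst; ring.
apply: (is_derive_eq (is_derive_mul (is_derive_cst s x 1)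
  (@is_derive1_comp R (@tanh R) (fun y => s * (y - m)) x _ _
    (is_derive_tanh (s * (x - m))) d1))).
by rewrite /cst /=; ring.
Qed.

(** As [tanh] has square at most [1], the derivative [s^2 - w^2] lies between [0] and [s^2], and [w]
    is Lipschitz. *)
Lemma ac_real_riccati (R : realType) (s m a b : R) :
  ac_real a b (fun y => s * tanh (s * (y - m))).
Proof.
apply: (ac_real_lipschitz (K := s ^+ 2)) => x y _ xy _.
have [c ->] := is_derive_mvt xy (is_derive_riccati s m).
rewrite normrM [`|y - x|]ger0_norm ?subr_ge0 // ler_wpM2r ?subr_ge0 //.
rewrite exprMn; set T := tanh _ ^+ 2.
have T1 : T <= 1 by exact: sqr_tanh_le1.
have T0 : 0 <= T by exact: sqr_ge0.
have s2 := sqr_ge0 s.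
have := ler_piMr s2 T1; have := mulr_ge0 s2 T0.
by rewrite ler_norml; lra.
Qed.

(** A Riccati solution centred at the midpoint takes opposite values at the two ends, so [p 0 ^+ 2]
    and [p l ^+ 2] receive the same weight. *)
Lemma internal_edge_energy (R : realType) (l s : R) (p p1 p2 : R -> R) :
  real_edge (Some l) p p1 p2 -> 0 < l ->
  p 0 * p1 0 - p l * p1 l + s * tanh (l * s / 2) * (p 0 ^+ 2 + p l ^+ 2) <=
  \int[@lebesgue_measure R]_(t in `[0, l]) (s ^+ 2 * (p t * p t) - p t * p2 t).
Proof.
move=> ep l0.
have ll : edge_set (Some l) l by rewrite /= in_itv /= lexx ltW.
have := real_edge_energy ep l0 ll (ac_real_riccati s (l / 2) 0 l) (is_derive_riccati s (l / 2)).
have -> : s * (l - l / 2) = l * s / 2 by lra.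
have -> : s * (0 - l / 2) = - (l * s / 2) by lra.
rewrite tanhN; lra.
Qed.

(** The constant solution [w = - s] is used on [[0, b]], with [b] so far out that the tail of the
    integral and the boundary terms at [b] each cost at most [e / 2]. *)
Lemma external_edge_energy (R : realType) (s : R) (p p1 p2 : R -> R) :
  real_edge None p p1 p2 -> 0 <= s ->
  p 0 * p1 0 + s * p 0 ^+ 2 <=
  \int[@lebesgue_measure R]_(t in `[0, +oo[) (s ^+ 2 * (p t * p t) - p t * p2 t).
Proof.
move=> ep s0; apply/ler_addgt0Pr => e e0.
have [intpp intpp2] := integrable_real_edge ep ep.
have intf : (@lebesgue_measure R).-integrable `[0, +oo[
    (EFin \o (fun t => s ^+ 2 * (p t * p t) - p t * p2 t)).
  have mE : measurable (edge_set (None : option R)) by exact: measurable_edge_set.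
  by apply: integrable_subr => //; apply: integrable_mulrl.
have e20 : 0 < e / 2 by rewrite divr_gt0.
have s1 : 0 < s + 1 by rewrite ltr_wpDl.
(* The boundary terms at [b] are at most [s + 1] times the quantity that is made small. *)
have d0 : 0 < e / 2 / (s + 1) by rewrite divr_gt0.
have [c c0 Hc] := Rintegral_itv_cvgy e20 intf.
(* The same function is used twice; starting from [c + 1] makes [b] positive. *)
have [b cb small] := real_edge_vanishing ep ep d0 (addr_ge0 c0 ler01).
have b0 : 0 < b by lra.
have cst_riccati (x : R) : is_derive x 1 (cst (- s)) (s ^+ 2 - (cst (- s) x) ^+ 2).
  by rewrite /cst sqrrN subrr; exact: is_derive_cst.
have acc : ac_real 0 b (cst (- s)).
  apply: (ac_real_lipschitz (K := 0)) => x y _ _ _.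
  by rewrite /cst subrr normr0 mul0r.
have := real_edge_energy ep b0 (edge_setNone (ltW b0)) acc cst_riccati.
rewrite /cst; have := Hc b _.
have -> : c <= b by lra.
move=> /(_ erefl); rewrite ltr_norml => /andP[].
move: small; rewrite ltr_pdivlMr //.
have := mulr_ge0 s0 (sqr_ge0 (p1 b)); have := mulr_ge0 s0 (sqr_ge0 (p b)).
have := sqr_ge0 (p b - p1 b); have := sqr_ge0 (p1 b); have := sqr_ge0 (p b).
lra.
Qed.

(** The Wronskian is negligible at a point [b] where both functions and their derivatives are small
    at once; hence the two functions in [real_edge_vanishing]. *)
Lemma external_edge_wronskian (R : realType) (p p1 p2 q q1 q2 : R -> R) :
  real_edge None p p1 p2 -> real_edge None q q1 q2 ->
  \int[@lebesgue_measure R]_(t in `[0, +oo[) (p t * q2 t - q t * p2 t) =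
  - (p 0 * q1 0 - q 0 * p1 0).
Proof.
move=> ep eq.
have [_ intpq] := integrable_real_edge ep eq.
have [_ intqp] := integrable_real_edge eq ep.
have intf : (@lebesgue_measure R).-integrable `[0, +oo[
    (EFin \o (fun t => p t * q2 t - q t * p2 t)).
  by apply: integrable_subr => //; exact: (measurable_edge_set None).
apply/eqP; rewrite -subr_eq0 -normr_le0; apply/ler_addgt0Pr => e e0; rewrite add0r.
have e20 : 0 < e / 2 by rewrite divr_gt0.
have [c c0 Hc] := Rintegral_itv_cvgy e20 intf.
have [b cb small] := real_edge_vanishing ep eq e20 (addr_ge0 c0 ler01).
have b0 : 0 < b by lra.
have E := real_edge_wronskian ep eq b0 (edge_setNone (ltW b0)).
have := Hc b _; have -> : c <= b by lra.
move=> /(_ erefl); rewrite {}E ltr_norml ler_norml => /andP[].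
have := sqr_ge0 (p b + q1 b); have := sqr_ge0 (p b - q1 b).
have := sqr_ge0 (q b + p1 b); have := sqr_ge0 (q b - p1 b).
move: small; lra.
Qed.

(** * The boundary form *)

Lemma adjmxE (R : realType) (m n : nat) (M : 'M[R[i]]_(m, n)) i j :
  adjmx M i j = conjc (M j i).
Proof. by rewrite !mxE. Qed.

Lemma adjmxM (R : realType) (m n p : nat) (M : 'M[R[i]]_(m, n)) (N : 'M[R[i]]_(n, p)) :
  adjmx (M *m N) = adjmx N *m adjmx M.
Proof. by rewrite /adjmx map_mxM trmx_mul. Qed.

Lemma adjmxK (R : realType) (m n : nat) (M : 'M[R[i]]_(m, n)) : adjmx (adjmx M) = M.
Proof. by apply/matrixP => i j; rewrite !mxE conjcK. Qed.

(** The rank is the dimension of a sum of two subspaces, which depends neither on their order nor on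
    a sign. *)
Lemma mxrank_row_mxC (F : fieldType) (m n p : nat) (A : 'M[F]_(m, n)) (B : 'M[F]_(m, p)) :
  \rank (row_mx (- B) A) = \rank (row_mx A B).
Proof.
rewrite -mxrank_tr -[RHS]mxrank_tr !tr_row_mx -!addsmxE [in RHS]addsmxC.
by rewrite (adds_eqmx (_ : (_ :=: B^T)%MS) (eqmx_refl _)) // raddfN; exact: eqmx_opp.
Qed.

(* The columns of [col_mx (- adjmx B) (adjmx A)] lie in the kernel of
   [row_mx A B] and span a subspace of the same dimension [n]. *)
Lemma maximal_isotropicE (R : realType) (n : nat) (A B : 'M[R[i]]_n) (x y : 'cV[R[i]]_n) :
  \rank (row_mx A B) = n -> A *m adjmx B = adjmx (A *m adjmx B) ->
  A *m x + B *m y = 0 ->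
  exists z : 'cV[R[i]]_n, x = - (adjmx B *m z) /\ y = adjmx A *m z.
Proof.
move=> rAB hsa hxy.
pose M := row_mx A B.
(* The transpose of the block column above, since kernels and ranks refer to row vectors. *)
pose N := row_mx (- map_mx (@conjc R) B) (map_mx (@conjc R) A).
have rN : \rank N = n by rewrite mxrank_row_mxC -map_row_mx mxrank_map.
have NM : N *m M^T = 0.
  rewrite /N /M tr_row_mx mul_row_col mulNmx addrC; apply/eqP; rewrite subr_eq0; apply/eqP.
  apply: trmx_inj; rewrite !trmx_mul !trmxK.
  move: hsa; rewrite adjmxM adjmxK /adjmx => ->.
  by [].
have sN : (N <= kermx M^T)%MS by exact/sub_kermxP.
(* The kernel has dimension [2 n - n = n], the rank of [N], so the inclusion is an equality. *)
have sk : (kermx M^T <= N)%MS.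
  have := mxrank_leqif_eq sN; rewrite mxrank_ker mxrank_tr rAB rN addnK.
  by case=> _; rewrite eqxx => /esym /andP[].
have : (row_mx x^T y^T <= kermx M^T)%MS.
  apply/sub_kermxP; rewrite /M tr_row_mx mul_row_col -!trmx_mul -raddfD /= hxy.
  by rewrite trmx0.
move=> /submx_trans /(_ sk) /submxP[D]; rewrite mul_mx_row => /eq_row_mx[xD yD].
exists D^T; split; apply: trmx_inj.
- by rewrite xD [RHS]raddfN /= trmx_mul trmxK /adjmx trmxK mulmxN.
- by rewrite yD trmx_mul trmxK /adjmx trmxK.
Qed.

(* Writing [x = - B^* z] and [y = A^* z], the vector [y + L x] lies in the kernel of
   [B] while [x] is orthogonal to it. *)
Lemma boundary_form (R : realType) (n : nat) (A B L : 'M[R[i]]_n) (x y : 'cV[R[i]]_n) :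
  \rank (row_mx A B) = n -> A *m adjmx B = adjmx (A *m adjmx B) -> is_L A B L ->
  A *m x + B *m y = 0 ->
  adjmx x *m y = - (adjmx x *m (L *m x)).
Proof.
move=> rAB hsa [P [[PP Padj BP Pker] hL]] hxy.
have [z [xz yz]] := maximal_isotropicE rAB hsa hxy.
have PB : P *m adjmx B = 0.
  by rewrite -Padj -adjmxM BP; apply/matrixP => i j; rewrite !mxE conjc0.
have Px : P *m x = 0 by rewrite xz mulmxN mulmxA PB mul0mx oppr0.
have BxyL : B *m (y + L *m x) = 0.
  rewrite mulmxDr (hL x).2 mulmxBl mul1mx Px subr0 addrC; exact: hxy.
(* The projection [P] fixes [y + L x]; moved to the other side of the pairing, it meets
   [P x = 0]. *)
have /(congr1 (mulmx (adjmx x))) := Pker _ BxyL.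
rewrite mulmxA -{1}Padj -adjmxM Px.
have -> : adjmx (0 : 'cV[R[i]]_n) = 0 by apply/matrixP => i j; rewrite !mxE conjc0.
by rewrite mul0mx mulmxDr => /esym /eqP; rewrite addr_eq0 => /eqP.
Qed.

(** * Norms and the positive part of a self-adjoint matrix *)

Lemma conjc_mul_normc (R : realType) (z : R[i]) :
  conjc z * z = RtoC (ComplexField.Normc.normc z ^+ 2).
Proof.
case: z => a b /=; rewrite sqr_sqrtr ?addr_ge0 ?sqr_ge0 //.
by apply/eqP; rewrite eq_complex /= !expr2; apply/andP; split; apply/eqP; ring.
Qed.

Lemma RtoC_sum (R : realType) (I : Type) (r : seq I) (P : pred I) (F : I -> R) :
  RtoC (\sum_(i <- r | P i) F i) = \sum_(i <- r | P i) RtoC (F i).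
Proof. exact: (raddf_sum (real_complex R)). Qed.

Lemma adjmx_vnorm2 (R : realType) (n : nat) (x : 'cV[R[i]]_n) :
  (adjmx x *m x) 0 0 = RtoC (vnorm2 x).
Proof.
rewrite mxE RtoC_sum; apply: eq_bigr => k _.
by rewrite !mxE conjc_mul_normc.
Qed.

Lemma vnorm2_unitary (R : realType) (n : nat) (U : 'M[R[i]]_n) (x : 'cV[R[i]]_n) :
  adjmx U *m U = 1%:M -> vnorm2 (U *m x) = vnorm2 x.
Proof.
move=> UU; suff : RtoC (vnorm2 (U *m x)) = RtoC (vnorm2 x) by case.
by rewrite -!adjmx_vnorm2 adjmxM -mulmxA (mulmxA (adjmx U)) UU mul1mx.
Qed.

Lemma vnorm2_ge0 (R : realType) (n : nat) (x : 'cV[R[i]]_n) : 0 <= vnorm2 x.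
Proof. by apply: sumr_ge0 => k _; exact: sqr_ge0. Qed.

Lemma vnorm2_diag (R : realType) (n : nat) (d : 'I_n -> R) (x : 'cV[R[i]]_n) :
  vnorm2 (diag_mx (\row_k RtoC (d k)) *m x) =
  \sum_(k < n) d k ^+ 2 * ComplexField.Normc.normc (x k 0) ^+ 2.
Proof.
apply: eq_bigr => k _; rewrite mul_diag_mx !mxE ComplexField.Normc.normcM exprMn.
by rewrite /= expr0n /= addr0 sqr_sqrtr ?sqr_ge0.
Qed.

(** The value [|d k|] is the norm of the image of the unit vector [U *m e], with [e] the basis
    vector of index [k]. *)
Lemma opnorm_unitary_diag (R : realType) (n : nat) (U : 'M[R[i]]_n) (d : 'I_n -> R) (k : 'I_n) :
  adjmx U *m U = 1%:M ->
  `|d k| <= opnorm (U *m diag_mx (\row_k RtoC (d k)) *m adjmx U).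
Proof.
move=> UU; have UU' : U *m adjmx U = 1%:M by exact: mulmx1C.
have UUadj : adjmx (adjmx U) *m adjmx U = 1%:M by rewrite adjmxK.
pose M := \sum_(k < n) d k ^+ 2.
have normD x : vnorm2 (U *m diag_mx (\row_k RtoC (d k)) *m adjmx U *m x) =
    vnorm2 (diag_mx (\row_k RtoC (d k)) *m (adjmx U *m x)).
  by rewrite -!mulmxA vnorm2_unitary.
(* The set must first be bounded: coordinates of a unit vector have modulus at most [1], which gives
   the bound [Num.sqrt M]. *)
apply: ub_le_sup.
  exists (Num.sqrt M) => _ [x [x1 ->]]; rewrite /vnorm ler_sqrt; last first.
    by apply: sumr_ge0 => j _; exact: sqr_ge0.
  rewrite normD vnorm2_diag; apply: ler_sum => j _.
  rewrite ler_piMr ?sqr_ge0 //.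
  have <- : vnorm2 (adjmx U *m x) = 1.
    rewrite vnorm2_unitary // -(sqr_sqrtr (vnorm2_ge0 x)).
    by move: x1; rewrite /vnorm => ->; rewrite expr1n.
  by rewrite /vnorm2 (bigD1 j) //= lerDl; apply: sumr_ge0 => i _; exact: sqr_ge0.
pose e : 'cV[R[i]]_n := delta_mx k 0.
have ek j : ComplexField.Normc.normc (e j 0) ^+ 2 = (j == k)%:R.
  rewrite mxE eqxx andbT; case: (j == k).
    by rewrite ComplexField.Normc.normc1 expr1n.
  by rewrite ComplexField.Normc.normc0 expr0n.
exists (U *m e); split.
  rewrite /vnorm vnorm2_unitary // /vnorm2 (bigD1 k) //= big1 ?ek ?eqxx ?addr0 ?sqrtr1 //.
  by move=> j jk; rewrite ek (negbTE jk).
rewrite /vnorm normD (mulmxA (adjmx U)) UU mul1mx vnorm2_diag (bigD1 k) //= big1 ?ek ?eqxx ?addr0 ?mulr1.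
  by rewrite sqrtr_sqr.
by move=> j jk; rewrite ek (negbTE jk) mulr0.
Qed.

(** In the coordinates [adjmx U *m x] the form is a sum of [d k] times squared moduli, and
    [d k <= Num.max (d k) 0 <= opnorm Lp]. The real witness [c] also records that the form is
    real. *)
Lemma pos_part_form (R : realType) (n : nat) (L Lp : 'M[R[i]]_n) (x : 'cV[R[i]]_n) :
  is_pos_part L Lp ->
  exists2 c : R, (adjmx x *m (L *m x)) 0 0 = RtoC c & c <= opnorm Lp * vnorm2 x.
Proof.
move=> [U [d [UU -> ->]]].
have UU' : U *m adjmx U = 1%:M by exact: mulmx1C.
pose v := adjmx U *m x.
exists (\sum_(k < n) d k * ComplexField.Normc.normc (v k 0) ^+ 2).
  rewrite -!mulmxA -/v mulmxA.
  have -> : adjmx x *m U = adjmx v by rewrite adjmxM adjmxK.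
  rewrite mxE RtoC_sum; apply: eq_bigr => k _.
  rewrite mul_diag_mx !mxE mulrCA conjc_mul_normc.
  by rewrite [RHS](rmorphM (real_complex R)).
have -> : vnorm2 x = vnorm2 v by rewrite vnorm2_unitary // adjmxK.
rewrite /vnorm2 mulr_sumr; apply: ler_sum => k _.
apply: ler_wpM2r; first exact: sqr_ge0.
have := opnorm_unitary_diag (fun k => Num.max (d k) 0) k UU.
by apply: le_trans; rewrite (le_trans _ (ler_norm _)) // le_max lexx.
Qed.

(** * Summation over the edges *)

Lemma Rintegral_edge_lin (R : realType) (len : option R) (k m : R) (f g : R -> R) :
  (@lebesgue_measure R).-integrable (edge_set len) (EFin \o f) ->
  (@lebesgue_measure R).-integrable (edge_set len) (EFin \o g) ->
  \int[@lebesgue_measure R]_(t in edge_set len) (k * f t + m * g t) =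
  k * \int[@lebesgue_measure R]_(t in edge_set len) f t +
  m * \int[@lebesgue_measure R]_(t in edge_set len) g t.
Proof.
move=> intf intg; have mE := measurable_edge_set len.
rewrite RintegralD; [|exact: mE|exact: integrable_mulrl|exact: integrable_mulrl].
by rewrite !RintegralZl //; exact: mE.
Qed.

(** With [psi = p + i q] the energy splits into two real energies, while the imaginary part of the
    form is minus an integrated Wronskian of [p] and [q]. *)
Lemma cint_energy (R : realType) (len : option R) (s : R) (psi dpsi ddpsi : R -> R[i]) :
  in_D_edge len psi dpsi ddpsi ->
  let p x := complex.Re (psi x) in let p2 x := complex.Re (ddpsi x) in
  let q x := complex.Im (psi x) in let q2 x := complex.Im (ddpsi x) in
  [/\ complex.Re (cint len (fun x => conjc (psi x) * - ddpsi x)) +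
      s ^+ 2 * complex.Re (cint len (fun x => conjc (psi x) * psi x)) =
      \int[@lebesgue_measure R]_(t in edge_set len) (s ^+ 2 * (p t * p t) - p t * p2 t) +
      \int[@lebesgue_measure R]_(t in edge_set len) (s ^+ 2 * (q t * q t) - q t * q2 t),
      complex.Im (cint len (fun x => conjc (psi x) * - ddpsi x)) =
      - \int[@lebesgue_measure R]_(t in edge_set len) (p t * q2 t - q t * p2 t) &
      complex.Im (cint len (fun x => conjc (psi x) * psi x)) = 0].
Proof.
move=> /in_D_edge_real[ep eq] p p2 q q2.
have [intpp intpp2] := integrable_real_edge ep ep.
have [intqq intqq2] := integrable_real_edge eq eq.
have [_ intpq2] := integrable_real_edge ep eq.
have [_ intqp2] := integrable_real_edge eq ep.
split.
- have E1 : complex.Re (cint len (fun x => conjc (psi x) * - ddpsi x)) =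
      \int[@lebesgue_measure R]_(t in edge_set len) (-1 * (p t * p2 t) + -1 * (q t * q2 t)).
    apply: eq_Rintegral => t _; rewrite /p /p2 /q /q2.
    by case: (psi t) => x y; case: (ddpsi t) => z w /=; ring.
  have E2 : complex.Re (cint len (fun x => conjc (psi x) * psi x)) =
      \int[@lebesgue_measure R]_(t in edge_set len) (1 * (p t * p t) + 1 * (q t * q t)).
    apply: eq_Rintegral => t _; rewrite /p /q.
    by case: (psi t) => x y /=; ring.
  have E3 f f2 : \int[@lebesgue_measure R]_(t in edge_set len) (s ^+ 2 * (f t * f t) - f t * f2 t) =
      \int[@lebesgue_measure R]_(t in edge_set len) (s ^+ 2 * (f t * f t) + -1 * (f t * f2 t)).
    by apply: eq_Rintegral => t _; ring.
  by rewrite E1 E2 !E3 !Rintegral_edge_lin //; ring.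
- have E1 : complex.Im (cint len (fun x => conjc (psi x) * - ddpsi x)) =
      \int[@lebesgue_measure R]_(t in edge_set len) (-1 * (p t * q2 t) + 1 * (q t * p2 t)).
    apply: eq_Rintegral => t _; rewrite /p /p2 /q /q2.
    by case: (psi t) => x y; case: (ddpsi t) => z w /=; ring.
  have E2 : \int[@lebesgue_measure R]_(t in edge_set len) (p t * q2 t - q t * p2 t) =
      \int[@lebesgue_measure R]_(t in edge_set len) (1 * (p t * q2 t) + -1 * (q t * p2 t)).
    by apply: eq_Rintegral => t _; ring.
  by rewrite E1 E2 !Rintegral_edge_lin //; ring.
- rewrite /cint /= (_ : Rintegral _ _ _ =
      \int[@lebesgue_measure R]_(t in edge_set len) (0 * (p t * p t) + 0 * (p t * p t))).
    by rewrite Rintegral_edge_lin // !mul0r addr0.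
  apply: eq_Rintegral => t _.
  by case: (psi t) => x y /=; ring.
Qed.

(** The imaginary part is kept as an exact boundary term, because only the sum of these terms over
    all edges vanishes. *)
Lemma external_edge_form (R : realType) (s : R) (psi dpsi ddpsi : R -> R[i]) :
  in_D_edge None psi dpsi ddpsi -> 0 <= s ->
  [/\ complex.Re (conjc (psi 0) * dpsi 0) + s * ComplexField.Normc.normc (psi 0) ^+ 2 <=
      complex.Re (cint None (fun x => conjc (psi x) * - ddpsi x)) +
      s ^+ 2 * complex.Re (cint None (fun x => conjc (psi x) * psi x)),
      complex.Im (cint None (fun x => conjc (psi x) * - ddpsi x)) =
      complex.Im (conjc (psi 0) * dpsi 0) &
      complex.Im (cint None (fun x => conjc (psi x) * psi x)) = 0].
Proof.
move=> D s0; have [E1 E2 E3] := cint_energy s D; have [ep eq] := in_D_edge_real D.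
split=> //.
- rewrite E1; have := external_edge_energy ep s0; have := external_edge_energy eq s0.
  rewrite normc_sqrE; case: (psi 0) => x y; case: (dpsi 0) => z w /=; lra.
- rewrite E2 (external_edge_wronskian ep eq).
  by case: (psi 0) => x y; case: (dpsi 0) => z w /=; ring.
Qed.

Lemma internal_edge_form (R : realType) (l s : R) (psi dpsi ddpsi : R -> R[i]) :
  in_D_edge (Some l) psi dpsi ddpsi -> 0 < l ->
  [/\ complex.Re (conjc (psi 0) * dpsi 0) + complex.Re (conjc (psi l) * - dpsi l) +
      s * tanh (l * s / 2) *
        (ComplexField.Normc.normc (psi 0) ^+ 2 + ComplexField.Normc.normc (psi l) ^+ 2) <=
      complex.Re (cint (Some l) (fun x => conjc (psi x) * - ddpsi x)) +
      s ^+ 2 * complex.Re (cint (Some l) (fun x => conjc (psi x) * psi x)),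
      complex.Im (cint (Some l) (fun x => conjc (psi x) * - ddpsi x)) =
      complex.Im (conjc (psi 0) * dpsi 0) + complex.Im (conjc (psi l) * - dpsi l) &
      complex.Im (cint (Some l) (fun x => conjc (psi x) * psi x)) = 0].
Proof.
move=> D l0; have [E1 E2 E3] := cint_energy s D; have [ep eq] := in_D_edge_real D.
have ll : edge_set (Some l) l by rewrite /= in_itv /= lexx ltW.
split=> //.
- rewrite E1; have := internal_edge_energy s ep l0; have := internal_edge_energy s eq l0.
  rewrite !normc_sqrE; case: (psi 0) => x y; case: (dpsi 0) => z w.
  case: (psi l) => x' y'; case: (dpsi l) => z' w' /=; lra.
- rewrite E2 (real_edge_wronskian ep eq l0 ll).
  case: (psi 0) => x y; case: (dpsi 0) => z w.
  by case: (psi l) => x' y'; case: (dpsi l) => z' w' /=; ring.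
Qed.

Lemma Re_sum (R : realType) (I : Type) (r : seq I) (P : pred I) (F : I -> R[i]) :
  complex.Re (\sum_(i <- r | P i) F i) = \sum_(i <- r | P i) complex.Re (F i).
Proof. by apply: (big_morph (@complex.Re R)) => // -[? ?] [? ?]. Qed.

Lemma Im_sum (R : realType) (I : Type) (r : seq I) (P : pred I) (F : I -> R[i]) :
  complex.Im (\sum_(i <- r | P i) F i) = \sum_(i <- r | P i) complex.Im (F i).
Proof. by apply: (big_morph (@complex.Im R)) => // -[? ?] [? ?]. Qed.

Lemma ReD (R : realType) (x y : R[i]) : complex.Re (x + y) = complex.Re x + complex.Re y.
Proof. by case: x; case: y. Qed.

Lemma ImD (R : realType) (x y : R[i]) : complex.Im (x + y) = complex.Im x + complex.Im y.
Proof. by case: x; case: y. Qed.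

Lemma boundary_dot (R : realType) (nE nI : nat) (a : 'I_nI -> R)
    (psiE dpsiE : 'I_nE -> R -> R[i]) (psiI dpsiI : 'I_nI -> R -> R[i]) :
  (adjmx (bval a psiE psiI) *m bdval a dpsiE dpsiI) 0 0 =
  \sum_(e < nE) conjc (psiE e 0) * dpsiE e 0 +
  (\sum_(i < nI) conjc (psiI i 0) * dpsiI i 0 +
   \sum_(i < nI) conjc (psiI i (a i)) * - dpsiI i (a i)).
Proof.
rewrite mxE !big_split_ord /= -addrA; congr (_ + (_ + _)); apply: eq_bigr => k _.
- by rewrite adjmxE !col_mxEu !mxE.
- by rewrite adjmxE !col_mxEu !col_mxEd !mxE.
- by rewrite adjmxE !col_mxEd !mxE.
Qed.

Lemma boundary_norm (R : realType) (nE nI : nat) (a : 'I_nI -> R)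
    (psiE : 'I_nE -> R -> R[i]) (psiI : 'I_nI -> R -> R[i]) :
  vnorm2 (bval a psiE psiI) =
  \sum_(e < nE) ComplexField.Normc.normc (psiE e 0) ^+ 2 +
  \sum_(i < nI) (ComplexField.Normc.normc (psiI i 0) ^+ 2 +
                 ComplexField.Normc.normc (psiI i (a i)) ^+ 2).
Proof.
rewrite /vnorm2 !big_split_ord big_split /= -addrA; congr (_ + (_ + _)); apply: eq_bigr => k _.
- by rewrite !col_mxEu !mxE.
- by rewrite !col_mxEu !col_mxEd !mxE.
- by rewrite !col_mxEd !mxE.
Qed.

(** The lower bound is expressed through the quadratic form on the domain. As the order of [R[i]]
    requires equal imaginary parts, it also contains the reality of the form. *)
Theorem theorem3p10 (R : realType)
  (V : finType) (nE nI : nat)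
  (dm dp : 'I_nI -> V) (dE : 'I_nE -> V)
  (hconn : graph_connected dm dp)
  (a : 'I_nI -> R) (ha : forall i, 0 < a i)
  (hI : (0 < nI)%N)
  (amin : R) (hamin_le : forall i, amin <= a i) (hamin_att : exists i, a i = amin)
  (A B : 'M[R[i]]_(nE + nI + nI))
  (hrank : \rank (row_mx A B) = (nE + nI + nI)%N)
  (hsa : A *m adjmx B = adjmx (A *m adjmx B))
  (L Lp : 'M[R[i]]_(nE + nI + nI))
  (hL : is_L A B L) (hLp : is_pos_part L Lp)
  (s : R) (hs0 : 0 <= s) (hs : s * tanh (amin * s / 2) = opnorm Lp)
  (psiE dpsiE ddpsiE : 'I_nE -> R -> R[i])
  (psiI dpsiI ddpsiI : 'I_nI -> R -> R[i])
  (hDE : forall e, in_D_edge None (psiE e) (dpsiE e) (ddpsiE e))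
  (hDI : forall i, in_D_edge (Some (a i)) (psiI i) (dpsiI i) (ddpsiI i))
  (hbc : A *m bval a psiE psiI + B *m bdval a dpsiE dpsiI = 0) :
  RtoC (- s ^+ 2) * inner_H a psiE psiE psiI psiI
    <= inner_H a psiE (fun e x => - ddpsiE e x) psiI (fun i x => - ddpsiI i x).
Proof.
have [c Hc cle] := pos_part_form (bval a psiE psiI) hLp.
have bE : (adjmx (bval a psiE psiI) *m bdval a dpsiE dpsiI) 0 0 = - RtoC c.
  by rewrite (boundary_form hrank hsa hL hbc) mxE Hc.
rewrite boundary_dot in bE.
(* As [amin] is the least length and [tanh] is monotone, every internal edge has weight at least
   [opnorm Lp]; external edges do since [tanh] is below [1]. *)
have tI i : opnorm Lp <= s * tanh (a i * s / 2).
  by rewrite -hs ler_wpM2l // tanh_le // ler_pM2r // ler_wpM2r.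
have tE : opnorm Lp <= s.
  by rewrite -hs ler_piMr // (le_trans (ler_norm _)) // ltW // tanh_lt1.
have formE e := external_edge_form (hDE e) hs0.
have formI i := internal_edge_form s (hDI i) (ha i).
have ReE := congr1 (@complex.Re R) bE; have ImE := congr1 (@complex.Im R) bE.
rewrite !ReD !Re_sum /= in ReE; rewrite !ImD !Im_sum /= oppr0 in ImE.
have Re_mul (x : R) (z : R[i]) : complex.Re (RtoC x * z) = x * complex.Re z.
  by case: z => ? ? /=; rewrite mul0r subr0.
have Im_mul (x : R) (z : R[i]) : complex.Im (RtoC x * z) = x * complex.Im z.
  by case: z => ? ? /=; rewrite mul0r addr0.
rewrite lecE Re_mul Im_mul /inner_H !ReD !ImD !Re_sum !Im_sum.
(* Equality of imaginary parts comes first: squared norms are real, and the boundary terms sum to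
   zero by [ImE]. *)
apply/andP; split.
  apply/eqP.
  rewrite [in RHS]big1 => [|e _]; last by case: (formE e).
  rewrite [in RHS]big1 => [|i _]; last by case: (formI i).
  rewrite addr0 mulr0; apply: etrans ImE; rewrite -big_split /=; congr (_ + _).
    by apply: eq_bigr => e _; case: (formE e).
  by apply: eq_bigr => i _; case: (formI i).
rewrite mulNr lerNl -subr_ge0 opprK.
have lowE : \sum_(e < nE) (complex.Re (conjc (psiE e 0) * dpsiE e 0) +
      opnorm Lp * ComplexField.Normc.normc (psiE e 0) ^+ 2) <=
    \sum_(e < nE) (complex.Re (cint None (fun x => conjc (psiE e x) * - ddpsiE e x)) +
      s ^+ 2 * complex.Re (cint None (fun x => conjc (psiE e x) * psiE e x))).
  apply: ler_sum => e _; case: (formE e) => h _ _; apply: le_trans h.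
  by rewrite lerD2l ler_wpM2r ?sqr_ge0.
have lowI : \sum_(i < nI) (complex.Re (conjc (psiI i 0) * dpsiI i 0) +
      complex.Re (conjc (psiI i (a i)) * - dpsiI i (a i)) +
      opnorm Lp * (ComplexField.Normc.normc (psiI i 0) ^+ 2 +
        ComplexField.Normc.normc (psiI i (a i)) ^+ 2)) <=
    \sum_(i < nI) (complex.Re (cint (Some (a i)) (fun x => conjc (psiI i x) * - ddpsiI i x)) +
      s ^+ 2 * complex.Re (cint (Some (a i)) (fun x => conjc (psiI i x) * psiI i x))).
  apply: ler_sum => i _; case: (formI i) => h _ _; apply: le_trans h.
  by rewrite lerD2l ler_wpM2r // addr_ge0 // sqr_ge0.
(* The weights add up to [opnorm Lp] times the squared norm of the boundary values, which by [cle]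
   compensates the boundary form [- c]. *)
move: cle lowE lowI; rewrite boundary_norm !big_split /= -!mulr_sumr !big_split /=.
lra.
Qed.
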